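(* Let $\lambda$ be a positive integer and $d=2\lambda+2$. Then for $-1<x<1$ the thinplate spline function $k_{d,1}$ of the sphere $\mathbb{S}^{d-1}$ is $$k_{d,1}(x)=\left(\frac{\pi}{2}+\arcsin(x)\right)\sum_{j=1}^{\lambda}c_j^\lambda\, x\,(1-x^2)^{-j+\frac12}+\sum_{j=1}^{\lambda-1}d_j^\lambda\,(1-x^2)^{-j}-C_\lambda,$$ where $$c_j^\lambda=\frac{1}{2\lambda}\,\frac{1}{2j-1}\,\frac{(2j-1)!!}{(2j-2)!!},\qquad 1\le j\le\lambda,$$ $$d_j^\lambda=\frac{1}{2j}\left[\frac{(2\lambda-1)!!}{(2\lambda-2j-1)!!}\,\frac{(2\lambda-2j-2)!!}{(2\lambda)!!}-\frac{1}{2\lambda}\,\frac{(2j-1)!!}{(2j)!!}\right],\qquad 1\le j\le\lambda-1,$$ $$C_\lambda=\frac{1}{f_{\lambda-\frac12}}\left(\sum_{j=1}^{\lambda}\frac{1}{2(\lambda-j+1)}\,c_j^\lambda\, f_{\lambda-j+\frac12}+\sum_{j=1}^{\lambda-1}d_j^\lambda\, f_{\lambda-j-\frac12}\right),$$ and $$f_\mu=\int_{-1}^1(1-y^2)^\mu\,dy=\frac{\sqrt{\pi}\,\Gamma(\mu+1)}{\Gamma(\mu+3/2)},\qquad \mu>-1.$$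
   Context: Double factorials use the convention $0!!=1$. The thinplate spline function $k_{d,1}$, with $\lambda=\frac{d-2}{2}$, is defined by the series $$k_{d,1}(x)=\sum_{n=1}^\infty [n(n+d-2)]^{-1}N_{d,n}W_n^\lambda(x),$$ where $N_{d,n}=\binom{n+d-1}{n}-\binom{n+d-3}{n-2}$ (with $\binom{a}{-1}=0$) is the dimension of the space of spherical harmonics of degree $n\ge 1$ on $\mathbb{S}^{d-1}\subset\mathbb{R}^d$, and $W_n^\lambda$ is the Gegenbauer polynomial of order $\lambda$ and degree $n$ normalized so that $W_n^\lambda(1)=1$, i.e. $W_n^\lambda(x)={}_2F_1\left(-n,n+2\lambda;\lambda+\tfrac12;\tfrac{1-x}{2}\right)$. The series is viewed as an orthogonal expansion: with $[f,g]_\lambda=\int_{-1}^1 f(x)g(x)(1-x^2)^{\lambda-\frac12}dx$, $k_{d,1}$ is the function, continuous on $[-1,1)$ and integrable on $[-1,1]$ with respect to the weight $(1-x^2)^{\lambda-\frac12}$, such that $[k_{d,1},W_0^\lambda]_\lambda=0$ and $[k_{d,1},W_n^\lambda]_\lambda/[W_n^\lambda,W_n^\lambda]_\lambda=[n(n+d-2)]^{-1}N_{d,n}$ for $n\ge1$. *)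

(* Defs.v *)
From mathcomp Require Import all_boot all_order all_algebra.
From mathcomp Require Import all_classical all_reals all_analysis.

Set Implicit Arguments.
Unset Strict Implicit.
Unset Printing Implicit Defensive.

Import Order.TTheory GRing.Theory Num.Theory.
Import numFieldNormedType.Exports.

Local Open Scope classical_set_scope.
Local Open Scope ring_scope.

Fixpoint dfact (n : nat) : nat :=
  if n is m.+2 then (n * dfact m)%N else 1%N.

Definition pochhammer (R : realType) (a : R) (k : nat) : R :=
  \prod_(i < k) (a + i%:R).

(* The partial sums are eventually constant when [a] is a nonpositive integer
   and [c] is not one. *)
Definition hypergeometric2F1 (R : realType) (a b c z : R) : R :=
  limn (series (fun k : nat =>
    pochhammer a k * pochhammer b k / (pochhammer c k * k`!%:R) * z ^+ k)).

Definition gegenbauerW (R : realType) (lambda : R) (n : nat) (x : R) : R :=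
  hypergeometric2F1 (- n%:R) (n%:R + 2 * lambda) (lambda + 2^-1) ((1 - x) / 2).

Definition gegenbauer_weight (R : realType) (lambda x : R) : R :=
  (1 - x ^+ 2) `^ (lambda - 2^-1).

Definition gegenbauer_ip (R : realType) (lambda : R) (f g : R -> R) : R :=
  \int[@lebesgue_measure R]_(x in `[-1, 1])
     (f x * g x * gegenbauer_weight lambda x).

(* For n = 1 the second binomial coefficient has lower index -1 and vanishes;
   truncated subtraction would turn that index into 0. *)
Definition harmonic_dim (R : realType) (d n : nat) : R :=
  'C(n + d - 1, n)%:R - (if (n < 2)%N then 0 else 'C(n + d - 3, n - 2)%:R).

Definition sphere_lambda (R : realType) (d : nat) : R := (d%:R - 2) / 2.

(* [k] is a representative of the thinplate spline function k_{d,1}, which is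
   determined on [-1, 1[ only; the values of [k] elsewhere are irrelevant. *)
Definition is_thinplate_spline (R : realType) (d : nat) (k : R -> R) : Prop :=
  let lambda : R := sphere_lambda R d in
  let W := gegenbauerW lambda in
  [/\ {within `[-1, 1[, continuous k},
      (@lebesgue_measure R).-integrable `[-1, 1]
        (fun x => (k x * gegenbauer_weight lambda x)%:E),
      gegenbauer_ip lambda k (W 0%N) = 0 &
      forall n : nat, (1 <= n)%N ->
        gegenbauer_ip lambda k (W n) / gegenbauer_ip lambda (W n) (W n) =
        (n%:R * (n%:R + d%:R - 2))^-1 * harmonic_dim R d n].

Definition Gamma (R : realType) (z : R) : R :=
  \int[@lebesgue_measure R]_(t in `]0, +oo[) (t `^ (z - 1) * expR (- t)).

Definition fint (R : realType) (mu : R) : R :=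
  \int[@lebesgue_measure R]_(y in `[-1, 1]) ((1 - y ^+ 2) `^ mu).

Definition c_coef (R : realType) (l j : nat) : R :=
  (2 * l)%:R^-1 * (2 * j - 1)%:R^-1 *
  ((dfact (2 * j - 1))%:R / (dfact (2 * j - 2))%:R).

Definition d_coef (R : realType) (l j : nat) : R :=
  (2 * j)%:R^-1 *
  ((dfact (2 * l - 1))%:R / (dfact (2 * l - 2 * j - 1))%:R *
     ((dfact (2 * l - 2 * j - 2))%:R / (dfact (2 * l))%:R)
   - (2 * l)%:R^-1 * ((dfact (2 * j - 1))%:R / (dfact (2 * j))%:R)).

Definition C_const (R : realType) (l : nat) : R :=
  (fint (l%:R - 2^-1))^-1 *
  (\sum_(1 <= j < l.+1)
      (2 * (l%:R - j%:R + 1))^-1 * c_coef R l j * fint (l%:R - j%:R + 2^-1)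
   + \sum_(1 <= j < l) d_coef R l j * fint (l%:R - j%:R - 2^-1)).

(* Main.v *)
Require Import Defs.
From mathcomp Require Import all_boot all_order all_algebra.
From mathcomp Require Import all_classical all_reals all_analysis.
From mathcomp Require Import measurable_realfun ring lra zify.

Import Order.TTheory GRing.Theory Num.Theory.
Import numFieldNormedType.Exports.

Set Implicit Arguments.
Unset Strict Implicit.
Unset Printing Implicit Defensive.

Local Open Scope classical_set_scope.
Local Open Scope ring_scope.

(** Write l for the order lambda, s for the square root of 1 - x ^ 2, and
    w = s ^ (2 l - 1) for the weight.  Applied term by term to the series, the
    Gegenbauer operator y |-> (s ^ (2 l + 1) y')' / w produces the constant 1
    minus a multiple of a point mass at 1; on ]-1, 1[ this amounts to
    s ^ (2 l + 1) k' = B, where B x is the integral of w over [-1, x].  The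
    proof runs this backwards.

    The derivative of the closed form is B / s ^ (2 l + 1) ([der_spline]): the
    coefficients of the arcsine term telescope, and the coefficients of the
    algebraic terms are those of the reduction formula for B ([incbeta_sum]).
    Green's formula for the Gegenbauer operator then shows that the pairing of
    the closed form with the Gegenbauer polynomial W_n, multiplied by the
    eigenvalue n (n + 2 l), is B 1 for every n >= 1 ([int_splineW_gegW]), and
    the additive constant is the one that makes the pairing with W_0 vanish
    ([int_splineW]).  These are the prescribed coefficients because the squared
    norm of W_n times the dimension N_n does not depend on n ([gegnorm_dim]).

    The individual terms of the closed form blow up at -1, but its derivative
    stays between 0 and 1 on ]-1, 0], so it has a limit at -1 ([cvg_spline]);
    the extension by that limit is a spline ([spline_thinplate]).  Conversely,
    two splines have the same pairings with all polynomials, and a continuous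
    function is determined by these ([moments_eq0], [thinplate_unique]).

    For the Gamma quotient, (s - x ^ 2) ^ mu e ^ (- s) is integrated over the
    region x ^ 2 < s in the two possible orders ([beta_gamma]): one order gives
    a Gaussian integral times Gamma (mu + 1), the other the integral of
    (1 - y ^ 2) ^ mu times Gamma (mu + 3 / 2). *)

(** * Hypergeometric coefficients of the Gegenbauer polynomials *)

Section gegenbauer_polynomials.
Context {R : realType}.
Implicit Types (a x : R) (l n k : nat).

Lemma pochhammerSr a k : pochhammer a k.+1 = pochhammer a k * (a + k%:R).
Proof. by rewrite /pochhammer big_ord_recr. Qed.

Lemma pochhammerSl a k : pochhammer a k.+1 = a * pochhammer (a + 1) k.
Proof.
rewrite /pochhammer big_ord_recl addr0; congr (_ * _).
by apply: eq_bigr => i _; rewrite /bump /= natrD addrA.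
Qed.

Lemma pochhammer_gt0 a k : 0 < a -> 0 < pochhammer a k.
Proof. by move=> a0; apply: prodr_gt0 => i _; rewrite ltr_wpDr. Qed.

Lemma pochhammerN_eq0 n k : (n < k)%N -> pochhammer (- n%:R : R) k = 0.
Proof.
by move=> nk; rewrite /pochhammer (bigD1 (Ordinal nk)) //= addNr mul0r.
Qed.

Lemma pochhammerN_neq0 n k : (k <= n)%N -> pochhammer (- n%:R : R) k != 0.
Proof.
move=> kn; apply/prodf_neq0 => i _.
by rewrite addrC subr_eq0 eqr_nat ltn_eqF// (leq_trans (ltn_ord i)).
Qed.

Definition gegcoef l n k : R :=
  pochhammer (- n%:R) k * pochhammer (n%:R + 2 * l%:R) k /
  (pochhammer (l%:R + 2^-1) k * k`!%:R).

Let half_gt0 l : 0 < l%:R + 2^-1 :> R.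
Proof. by rewrite ltr_wpDl. Qed.

Let fact_neq0 k : k`!%:R != 0 :> R.
Proof. by rewrite pnatr_eq0 -lt0n fact_gt0. Qed.

Lemma gegcoef_rec l n k :
  (k%:R + 1) * (k%:R + l%:R + 2^-1) * gegcoef l n k.+1 =
  (k%:R - n%:R) * (k%:R + n%:R + 2 * l%:R) * gegcoef l n k.
Proof.
rewrite /gegcoef !pochhammerSr factS natrM -natr1.
have /lt0r_neq0 := pochhammer_gt0 k (half_gt0 l); move: (pochhammer _ k) => P.
move: (pochhammer _ k) (pochhammer _ k) (fact_neq0 k) => Q S f0 P0.
have k0 : 0 <= k%:R :> R := ler0n _ _; have l0 : 0 <= l%:R :> R := ler0n _ _.
by field; rewrite f0 P0 /=; apply/andP; split; rewrite gt_eqF//; lra.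
Qed.

(** Differentiation shifts the coefficients of a hypergeometric series and
    increments its parameters. *)
Lemma gegcoef_shift l n k :
  (k%:R + 1) * gegcoef l n.+1 k.+1 =
  - (n.+1%:R * (n.+1%:R + 2 * l%:R) / (l%:R + 2^-1)) * gegcoef l.+1 n k.
Proof.
rewrite /gegcoef !pochhammerSl factS natrM.
have -> : - n.+1%:R + 1 = - n%:R :> R by rewrite -natr1; ring.
have -> : n.+1%:R + 2 * l%:R + 1 = n%:R + 2 * l.+1%:R :> R.
  by rewrite -!natr1; ring.
have -> : l%:R + 2^-1 + 1 = l.+1%:R + 2^-1 :> R by rewrite -natr1; ring.
have /lt0r_neq0 := pochhammer_gt0 k (half_gt0 l.+1).
move: (pochhammer _ k) => P.
move: (pochhammer _ k) (pochhammer _ k) (fact_neq0 k) => Q S f0 P0.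
have k0 : 0 <= k%:R :> R := ler0n _ _; have l0 : 0 <= l%:R :> R := ler0n _ _.
rewrite -(natr1 k).
by field; rewrite f0 P0 /=; apply/andP; split; rewrite gt_eqF//; lra.
Qed.

Lemma gegcoef_eq0 l n k : (n < k)%N -> gegcoef l n k = 0.
Proof. by move=> nk; rewrite /gegcoef pochhammerN_eq0// !mul0r. Qed.

Lemma gegcoef_neq0 l n k : (0 < l)%N -> (k <= n)%N -> gegcoef l n k != 0.
Proof.
move=> l0 kn; rewrite /gegcoef mulf_neq0 ?invr_eq0 ?mulf_neq0 ?pochhammerN_neq0//.
  by rewrite gt_eqF// pochhammer_gt0// ltr_wpDl// mulr_gt0// ltr0n.
by rewrite gt_eqF// pochhammer_gt0.
Qed.

(** The truncation at n.+1 loses nothing, by [gegcoef_eq0]. *)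
Definition gegp l n : {poly R} := \poly_(k < n.+1) gegcoef l n k.

Lemma coef_gegp l n k : (gegp l n)`_k = gegcoef l n k.
Proof.
by rewrite coef_poly; case: ltnP => // nk; rewrite gegcoef_eq0.
Qed.

Lemma size_gegp l n : (0 < l)%N -> size (gegp l n) = n.+1.
Proof. by move=> l0; rewrite size_poly_eq// gegcoef_neq0. Qed.

Lemma deriv_gegp l n :
  (gegp l n.+1)^`() =
  - (n.+1%:R * (n.+1%:R + 2 * l%:R) / (l%:R + 2^-1)) *: gegp l.+1 n.
Proof.
apply/polyP => k; rewrite coef_deriv coefZ !coef_gegp -gegcoef_shift.
by rewrite -[LHS]mulr_natl -natr1.
Qed.

(** The coefficient of 'X^k on the left is the two-term recurrence [gegcoef_rec]. *)
Lemma gegp_ode l n :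
  'X * (1 - 'X) * (gegp l n)^`()^`() +
  (l%:R + 2^-1)%:P * (1 - 2%:P * 'X) * (gegp l n)^`() +
  (n%:R * (n%:R + 2 * l%:R))%:P * gegp l n = 0.
Proof.
set p := gegp l n.
have -> : 'X * (1 - 'X) * p^`()^`() + (l%:R + 2^-1)%:P * (1 - 2%:P * 'X) * p^`()
  + (n%:R * (n%:R + 2 * l%:R))%:P * p =
  'X * p^`()^`() - 'X * ('X * p^`()^`()) + (l%:R + 2^-1)%:P * p^`()
  - ((l%:R + 2^-1) * 2)%:P * ('X * p^`())
  + (n%:R * (n%:R + 2 * l%:R))%:P * p.
  rewrite !polyCM; ring.
apply/polyP => k; have := gegcoef_rec l n k.
rewrite !(coefD, coefN, coefCM, coefXM, coef_deriv) coef0 !coef_gegp.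
move/eqP; rewrite -subr_eq0 => /eqP h; rewrite -[RHS]h {h}.
by case: k => [|[|k]] /=; field.
Qed.

End gegenbauer_polynomials.

(** * The Gegenbauer polynomials as polynomials in x *)

Section gegenbauer_polynomials_in_x.
Context {R : realType}.
Implicit Types (x : R) (l n : nat).

(** The argument (1 - x) / 2 of the hypergeometric series. *)
Definition halfp : {poly R} := (2^-1)%:P * (1 - 'X).

Lemma halfpE x : halfp.[x] = (1 - x) / 2.
Proof. by rewrite /halfp !hornerE mulrC. Qed.

Lemma deriv_halfp : halfp^`() = - (2^-1)%:P.
Proof. by rewrite /halfp derivM derivB !derivC derivX; ring. Qed.

Lemma size_halfp : size halfp = 2%N.
Proof.
rewrite /halfp -opprB mulrN size_polyN size_Cmul ?invr_eq0//.
exact: size_XsubC.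
Qed.

Definition gegW l n : {poly R} := gegp l n \Po halfp.

Lemma gegenbauerWE l n x : gegenbauerW l%:R n x = (gegW l n).[x].
Proof.
rewrite /gegenbauerW /hypergeometric2F1 /gegW horner_comp halfpE.
apply/lim_near_cst => //; near=> N.
have nN : (n < N)%N by near: N; exact: nbhs_infty_gt.
rewrite /series /= (big_cat_nat (leq0n _) nN)//= [X in _ + X]big_nat.
rewrite [X in _ + X]big1 ?addr0.
  by rewrite horner_poly big_mkord.
move=> k /andP[nk _].
by have := gegcoef_eq0 (R := R) l nk; rewrite /gegcoef => ->; rewrite mul0r.
Unshelve. all: by end_near. Qed.

Lemma gegW0 l : gegW l 0 = 1.
Proof.
rewrite /gegW; suff -> : gegp l 0 = 1%:P :> {poly R} by rewrite comp_polyC.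
apply/polyP => -[|k]; rewrite coef_gegp coefC/=; last exact: gegcoef_eq0.
by rewrite /gegcoef /pochhammer !big_ord0 fact0 !mulr1 divr1.
Qed.

Lemma gegW_at1 l n : (gegW l n).[1] = 1.
Proof.
rewrite /gegW horner_comp halfpE subrr mul0r horner_coef0 coef_gegp.
by rewrite /gegcoef /pochhammer !big_ord0 fact0 !mulr1 divr1.
Qed.

Lemma size_gegW l n : (0 < l)%N -> size (gegW l n) = n.+1.
Proof. by move=> l0; rewrite size_comp_poly2 ?size_halfp// size_gegp. Qed.

Lemma deriv_gegW l n :
  (gegW l n.+1)^`() =
  (n.+1%:R * (n.+1%:R + 2 * l%:R) / (2 * l%:R + 1)) *: gegW l.+1 n.
Proof.
rewrite /gegW deriv_comp deriv_gegp deriv_halfp comp_polyZ -!mul_polyC.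
rewrite -polyCN mulrAC -polyCM; congr (_%:P * _).
have l0 : 0 <= l%:R :> R := ler0n _ _.
by field; rewrite gt_eqF//; lra.
Qed.

(** The hypergeometric equation after the substitution of (1 - x) / 2. *)
Lemma gegW_ode l n :
  (1 - 'X ^+ 2) * (gegW l n)^`()^`() - (2 * l%:R + 1)%:P * 'X * (gegW l n)^`() +
  (n%:R * (n%:R + 2 * l%:R))%:P * gegW l n = 0.
Proof.
pose c : {poly R} := (2^-1)%:P; pose L : {poly R} := l%:R%:P.
pose p : {poly R} := gegp l n.
have hc : c *+ 2 - 1 = 0.
  by apply/subr0_eq; rewrite subr0 -polyCMn -polyC1 -polyCB; congr (_%:P); field.
have D1 : (gegW l n)^`() = - c * (p^`() \Po halfp).
  by rewrite /gegW deriv_comp deriv_halfp; ring.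
have D2 : (gegW l n)^`()^`() = c * c * (p^`()^`() \Po halfp).
  by rewrite D1 derivM derivN derivC deriv_comp deriv_halfp; ring.
have /(congr1 (fun p => p \Po halfp)) := gegp_ode (R := R) l n.
rewrite /= !(comp_polyB, comp_polyD, comp_polyM, comp_polyC, comp_polyX).
rewrite -/(gegW l n) D2 D1 -/p {D1 D2}.
rewrite !(polyCD, polyCM) -/c -/L /halfp -/c => hW.
rewrite polyC1 polyC0 in hW *.
set w1 := _ \Po _ in hW *; set w2 := _ \Po _ in hW *; set N := _ * _ * gegW l n.
(* the left-hand sides of the goal and of hW differ by a multiple of 2 c - 1 *)
transitivity ((c *+ 2 - 1) * (c * (1 - 'X) * w1 + (L + c - c * 'X) * w2)).
  rewrite -[RHS]addr0 -[X in _ = _ + X]hW -/N; ring.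
by rewrite hc mul0r.
Qed.

End gegenbauer_polynomials_in_x.

(** * Calculus on [-1, 1] *)

Section derivation_rules.
Context {R : realType}.
Implicit Types (f g : R -> R) (x a b c : R).

(** The rules below apply to functions given by their values and are composed by
    application; [derE] then replaces the derivative so built by the desired one. *)
Lemma derE f x a b : is_derive x 1 f a -> a = b -> is_derive x 1 f b.
Proof. by move=> df <-. Qed.

Lemma derD f g x a b : is_derive x 1 f a -> is_derive x 1 g b ->
  is_derive x 1 (fun y => f y + g y) (a + b).
Proof. by move=> df dg; exact: is_deriveD. Qed.

Lemma derN f x a : is_derive x 1 f a -> is_derive x 1 (fun y => - f y) (- a).
Proof. by move=> df; exact: is_deriveN. Qed.

Lemma derM f g x a b : is_derive x 1 f a -> is_derive x 1 g b ->
  is_derive x 1 (fun y => f y * g y) (a * g x + f x * b).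
Proof.
move=> df dg; have := is_deriveM df dg.
by move=> /is_derive_eq; apply; rewrite /GRing.scale /= addrC mulrC.
Qed.

Lemma derC c x : is_derive x 1 (fun=> c) 0.
Proof. exact: is_derive_cst. Qed.

Lemma derX x : is_derive x 1 (fun y : R => y) 1.
Proof. exact: is_derive_id. Qed.

Lemma derZ f c x a : is_derive x 1 f a -> is_derive x 1 (fun y => c * f y) (c * a).
Proof. by move=> df; apply: (derE (derM (derC c x) df)); ring. Qed.

Lemma derXn f x a n : is_derive x 1 f a ->
  is_derive x 1 (fun y => f y ^+ n.+1) (n.+1%:R * f x ^+ n * a).
Proof.
move=> df; elim: n => [|n ih].
  by apply: (derE df); rewrite expr0; ring.
rewrite (_ : (fun _ => _) = (fun y => f y * f y ^+ n.+1)); last first.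
  by apply/funext => y; rewrite -exprS.
by apply: (derE (derM df ih)); rewrite [f x ^+ n.+1]exprS -[n.+2%:R]natr1; ring.
Qed.

Lemma der_sum (I : Type) (r : seq I) (F : I -> R -> R) (dF : I -> R) x :
  (forall i, is_derive x 1 (F i) (dF i)) ->
  is_derive x 1 (fun y => \sum_(i <- r) F i y) (\sum_(i <- r) dF i).
Proof.
move=> dFi; elim: r => [|i r ih].
  rewrite big_nil (_ : (fun _ => _) = fun=> 0); first exact: derC.
  by apply/funext => y; rewrite big_nil.
rewrite big_cons (_ : (fun _ => _) = fun y => F i y + \sum_(j <- r) F j y).
  exact: derD.
by apply/funext => y; rewrite big_cons.
Qed.

Lemma derH (p : {poly R}) x : is_derive x 1 (horner p) p^`().[x].
Proof. exact: is_derive_poly. Qed.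

End derivation_rules.

Section continuity_rules.
Context {R : realType}.
Implicit Types (f g : R -> R) (A : set R).

Lemma ctsD A f g : {within A, continuous f} -> {within A, continuous g} ->
  {within A, continuous (fun x => f x + g x)}.
Proof. by move=> cf cg x; apply: cvgD; [exact: cf | exact: cg]. Qed.

Lemma ctsN A f : {within A, continuous f} -> {within A, continuous (fun x => - f x)}.
Proof. by move=> cf x; apply: cvgN; exact: cf. Qed.

Lemma ctsM A f g : {within A, continuous f} -> {within A, continuous g} ->
  {within A, continuous (fun x => f x * g x)}.
Proof. by move=> cf cg x; apply: cvgM; [exact: cf | exact: cg]. Qed.

Lemma ctsT A f : continuous f -> {within A, continuous f}.
Proof. by move=> cf; apply: continuous_subspaceT. Qed.

Lemma ctsC A (c : R) : {within A, continuous (fun=> c)}.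
Proof. by apply: ctsT => x; exact: cvg_cst. Qed.

Lemma cts_id A : {within A, continuous (fun x : R => x)}.
Proof. by apply: ctsT => x; exact: cvg_id. Qed.

Lemma ctsXn A f n : {within A, continuous f} ->
  {within A, continuous (fun x => f x ^+ n)}.
Proof.
move=> cf; elim: n => [|n ih].
  by rewrite (_ : (fun _ => _) = fun=> 1)//; exact: ctsC.
rewrite (_ : (fun _ => _) = fun x => f x * f x ^+ n); first exact: ctsM.
by apply/funext => y; rewrite exprS.
Qed.

Lemma cts_sum A (I : Type) (r : seq I) (F : I -> R -> R) :
  (forall i, {within A, continuous (F i)}) ->
  {within A, continuous (fun x => \sum_(i <- r) F i x)}.
Proof.
move=> cF; elim: r => [|i r ih].
  rewrite (_ : (fun _ => _) = fun=> 0); first exact: ctsC.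
  by apply/funext => y; rewrite big_nil.
rewrite (_ : (fun _ => _) = fun y => F i y + \sum_(j <- r) F j y).
  exact: ctsD.
by apply/funext => y; rewrite big_cons.
Qed.

Lemma ctsH A (p : {poly R}) : {within A, continuous (horner p)}.
Proof. by apply: ctsT => x; exact: continuous_horner. Qed.

End continuity_rules.

Section integrals_on_the_interval.
Context {R : realType}.
Let mu := @lebesgue_measure R.
Implicit Types (f g F : R -> R).

Lemma cts_integrable f : {within `[-1, 1], continuous f} ->
  mu.-integrable `[-1, 1] (EFin \o f).
Proof.
by move=> cf; apply: continuous_compact_integrable => //; exact: segment_compact.
Qed.

(** No derivative is required at the endpoints, where arcsine has none. *)
Lemma FTC_itv f F :
  {within `[-1, 1], continuous f} -> {within `[-1, 1], continuous F} ->
  (forall x : R, -1 < x < 1 -> is_derive x 1 F (f x)) ->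
  \int[mu]_(x in `[-1, 1]) f x = F 1 - F (-1).
Proof.
move=> cf cF dF; rewrite /Rintegral (@continuous_FTC2 _ f F)//.
- have N11 : -1 < 1 :> R by lra.
  have [_ F1 F2] := (continuous_within_itvP F N11).1 cF; split => // x.
  by rewrite in_itv/= => xI; have := dF x xI => -[].
- move=> x; rewrite in_itv/= => xI; have := dF x xI => dFx.
  by rewrite derive1E; exact: derive_val.
Qed.

Lemma RintD f g : {within `[-1, 1], continuous f} -> {within `[-1, 1], continuous g} ->
  \int[mu]_(x in `[-1, 1]) (f x + g x) =
  \int[mu]_(x in `[-1, 1]) f x + \int[mu]_(x in `[-1, 1]) g x.
Proof. by move=> cf cg; rewrite RintegralD//; exact: cts_integrable. Qed.

Lemma RintB f g : {within `[-1, 1], continuous f} -> {within `[-1, 1], continuous g} ->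
  \int[mu]_(x in `[-1, 1]) (f x - g x) =
  \int[mu]_(x in `[-1, 1]) f x - \int[mu]_(x in `[-1, 1]) g x.
Proof. by move=> cf cg; rewrite RintegralB//; exact: cts_integrable. Qed.

Lemma RintZ f (c : R) : {within `[-1, 1], continuous f} ->
  \int[mu]_(x in `[-1, 1]) (c * f x) = c * \int[mu]_(x in `[-1, 1]) f x.
Proof. by move=> cf; rewrite RintegralZl//; exact: cts_integrable. Qed.

Lemma Rint_sum (I : Type) (r : seq I) (F : I -> R -> R) :
  (forall i, {within `[-1, 1], continuous (F i)}) ->
  \int[mu]_(x in `[-1, 1]) (\sum_(i <- r) F i x) =
  \sum_(i <- r) \int[mu]_(x in `[-1, 1]) F i x.
Proof.
move=> cF; elim: r => [|i r ih].
  rewrite big_nil (_ : (fun _ => _) = fun=> 0); last first.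
    by apply/funext => y; rewrite big_nil.
  by rewrite Rintegral_cst// mul0r.
rewrite big_cons -ih -RintD//; last exact: cts_sum.
by congr Rintegral; apply/funext => y; rewrite big_cons.
Qed.

Lemma measurable_oo f g : {in `]-1, 1[, f =1 g} ->
  {within `[-1, 1], continuous g} -> measurable_fun `]-1 : R, 1[ f.
Proof.
move=> fg cg; have /integrableP[/measurable_EFinP mg _] := cts_integrable cg.
apply: (@eq_measurable_fun _ _ _ _ _ g).
  by move=> x; rewrite inE /= => xI; rewrite fg.
by apply: measurable_funS mg => //; apply: subset_itv_oo_cc.
Qed.

(** Splines are known on the open interval only, while their product with the
    weight extends continuously to the closed one. *)
Lemma eq_Rintegral_oo f g : {in `]-1, 1[, f =1 g} ->
  {within `[-1, 1], continuous g} ->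
  \int[mu]_(x in `[-1, 1]) f x = \int[mu]_(x in `[-1, 1]) g x.
Proof.
move=> fg cg; have mf := measurable_oo fg cg.
rewrite /Rintegral; congr fine.
have mg : measurable_fun `]-1 : R, 1[ g by exact: (@measurable_oo g g).
rewrite integral_itv_bndoo; last exact/measurable_EFinP.
transitivity (\int[mu]_(x in `](-1)%R, 1%R[) (g x)%:E)%E.
  by apply: eq_integral => x; rewrite inE /= => xI; rewrite fg.
by rewrite -(@integral_itv_bndoo _ _ _ _ true false)//; exact/measurable_EFinP.
Qed.

Lemma integrable_oo f g : {in `]-1, 1[, f =1 g} ->
  {within `[-1, 1], continuous g} -> mu.-integrable `[-1, 1] (EFin \o f).
Proof.
move=> fg cg; have mf := measurable_oo fg cg.
have mg : measurable_fun `]-1 : R, 1[ g by exact: (@measurable_oo g g).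
have /integrableP[_ ig] := cts_integrable cg.
apply/integrableP; split.
  by apply/measurable_EFinP/measurable_fun_itv_obnd_cbndP/measurable_fun_itv_bndo_bndcP.
have normP (h : R -> R) : measurable_fun `]-1 : R, 1[ h ->
    measurable_fun `]-1 : R, 1[ (fun x => `|(EFin \o h) x|%E).
  by move=> mh; apply: measurableT_comp => //; exact/measurable_EFinP.
move: ig; rewrite integral_itv_bndoo; last exact: normP.
rewrite [X in _ -> (X < _)%E]integral_itv_bndoo; last exact: normP.
congr (_ < _)%E; apply: eq_integral => x.
by rewrite inE /= => xI; rewrite fg.
Qed.

End integrals_on_the_interval.

(** * The half circle, the weight and the arcsine *)

Section semicircle.
Context {R : realType}.
Implicit Types (x : R) (l m k : nat).

Definition semicircle x : R := Num.sqrt (1 - x ^+ 2).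

Local Notation s := semicircle.

Lemma semicircle_gt0 x : -1 < x < 1 -> 0 < s x.
Proof. by move=> xI; rewrite sqrtr_gt0; nra. Qed.

Lemma semicircle_sqr x : -1 <= x <= 1 -> s x ^+ 2 = 1 - x ^+ 2.
Proof. by move=> xI; rewrite sqr_sqrtr//; nra. Qed.

Lemma semicircleN1 : s (-1) = 0.
Proof. by rewrite /s sqrrN expr1n subrr sqrtr0. Qed.

Lemma semicircle1 : s 1 = 0.
Proof. by rewrite /s expr1n subrr sqrtr0. Qed.

Lemma cts_semicircle A : {within A, continuous s}.
Proof.
apply: ctsT => x.
apply: (@continuous_comp _ _ _ (fun x : R => 1 - x ^+ 2) Num.sqrt).
  by apply: cvgB; [exact: cvg_cst | exact: exprn_continuous].
exact: sqrt_continuous.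
Qed.

Lemma der_semicircle x : -1 < x < 1 -> is_derive x 1 s (- x / s x).
Proof.
move=> xI; have s0 := semicircle_gt0 xI.
have u0 : 0 < 1 - x ^+ 2 by nra.
have du : is_derive x 1 (fun y : R => 1 - y ^+ 2) (0 - 2 * x).
  apply: (derE (derD (derC 1 x) (derN (derXn 1 (derX x))))); ring.
have := @is_derive1_comp _ (@Num.sqrt R) (fun y : R => 1 - y ^+ 2) x _ _
  (is_derive1_sqrt u0) du.
by move/derE; apply; rewrite /GRing.scale/= -/(s x); field; rewrite gt_eqF.
Qed.

Lemma der_semicircleX k x : -1 < x < 1 ->
  is_derive x 1 (fun y => s y ^+ k.+2) (- (k.+2%:R * x) * s x ^+ k).
Proof.
move=> xI; have s0 := semicircle_gt0 xI.
apply: (derE (derXn k.+1 (der_semicircle xI))).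
by rewrite exprS; field; rewrite gt_eqF.
Qed.

Lemma powR_semicircle m x : -1 <= x <= 1 ->
  (1 - x ^+ 2) `^ (m%:R + 2^-1) = s x ^+ (2 * m).+1.
Proof.
move=> xI; have u0 : 0 <= 1 - x ^+ 2 by nra.
have [->|m0] := eqVneq m 0%N; first by rewrite add0r muln0 expr1 powR12_sqrt.
rewrite powRD ?powR12_sqrt// ?powR_mulrn//; last first.
  by apply/implyP => /eqP; have := ler0n R m; lra.
by rewrite [RHS]exprSr [s x ^+ _]exprM semicircle_sqr.
Qed.

Lemma gegenbauer_weightE l x : (0 < l)%N -> -1 <= x <= 1 ->
  gegenbauer_weight l%:R x = s x ^+ (2 * l).-1.
Proof.
case: l => // l _ xI; rewrite /gegenbauer_weight.
have -> : l.+1%:R - 2^-1 = l%:R + 2^-1 :> R by rewrite -natr1; field.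
by rewrite powR_semicircle// mulnS.
Qed.

Definition phi x : R := pi / 2 + asin x.

Lemma phiN1 : phi (-1) = 0.
Proof.
have p0 : 0 < pi :> R := pi_gt0 R.
rewrite /phi -[X in asin (- X)](sin_pihalf R) -sinN sinK ?subrr// in_itv/=.
by apply/andP; split; lra.
Qed.

Lemma der_phi x : -1 < x < 1 -> is_derive x 1 phi (s x)^-1.
Proof.
move=> xI; apply: (derE (derD (derC _ x) (is_derive1_asin xI))).
by rewrite add0r.
Qed.

(** Up to the endpoints, as the inverse of the sine on a segment. *)
Lemma cts_phi : {within `[-1, 1], continuous phi}.
Proof.
apply: ctsD; first exact: ctsC.
have p0 : 0 < pi :> R := pi_gt0 R.
have := @segment_can_le_continuous R (- (pi / 2)) (pi / 2) sin asin.
rewrite sinN sin_pihalf; apply.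
- lra.
- exact/ctsT/continuous_sin.
- exact: sinK.
Qed.

End semicircle.

(** * The incomplete beta integral and the norms of the Gegenbauer polynomials *)

Section incomplete_beta.
Context {R : realType}.
Let mu := @lebesgue_measure R.
Implicit Types (x : R) (l m n k : nat).
Local Notation s := (@semicircle R).

(** The integral of s ^ (2 l - 1) over [-1, x], given by its reduction formula;
    for l = 0 it is the integral of 1 / s, that is pi / 2 + asin x. *)
Fixpoint incbeta l x : R :=
  if l is k.+1 then
    (2 * k%:R + 1) / (2 * k%:R + 2) * incbeta k x +
    x * s x ^+ (2 * k).+1 / (2 * k%:R + 2)
  else phi x.

(** The reduction formula comes from
    (x s ^ (2 k + 1))' = (2 k + 2) s ^ (2 k + 1) - (2 k + 1) s ^ (2 k - 1).  The
    derivative is written as a quotient in order to include l = 0. *)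
Lemma der_incbeta l x : -1 < x < 1 ->
  is_derive x 1 (incbeta l) (s x ^+ (2 * l) / s x).
Proof.
move=> xI; have s0 := semicircle_gt0 xI.
have s2 : s x ^+ 2 = 1 - x ^+ 2 by apply: semicircle_sqr; lra.
elim: l => [|k ih].
  by apply: (derE (der_phi xI)); rewrite expr0 mul1r.
have k0 : 0 <= k%:R :> R := ler0n _ _.
have ds : is_derive x 1 (fun y => s y ^+ (2 * k).+1)
    (- ((2 * k%:R + 1) * x) * s x ^+ (2 * k) / s x).
  apply: (derE (derXn (2 * k) (der_semicircle xI))).
  by rewrite -natr1 natrM; field; rewrite gt_eqF.
apply: (derE (derD (derZ _ ih) (derM (derM (derX x) ds) (derC _ x)))).
rewrite mulnS exprS exprS [s x ^+ (2 * k).+1]exprS.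
have -> : x * (- ((2 * k%:R + 1) * x) * s x ^+ (2 * k) / s x) =
   - ((2 * k%:R + 1) * (x ^+ 2) * s x ^+ (2 * k) / s x) by ring.
have -> : x ^+ 2 = 1 - s x ^+ 2 by rewrite s2; ring.
by field; rewrite (gt_eqF s0) gt_eqF//; lra.
Qed.

Lemma incbetaN1 l : incbeta l (-1) = 0.
Proof.
elim: l => [|k ih]; first exact: phiN1.
by rewrite /= ih semicircleN1 exprS mul0r !mulr0 mul0r addr0.
Qed.

Lemma cts_incbeta l : {within `[-1, 1], continuous (incbeta l)}.
Proof.
elim: l => [|k ih]; first exact: cts_phi.
apply: ctsD; first by apply: ctsM => //; exact: ctsC.
apply: ctsM; last exact: ctsC.
by apply: ctsM; [exact: cts_id | apply: ctsXn; exact: cts_semicircle].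
Qed.

Lemma incbetaS1 l :
  incbeta l.+1 1 = (2 * l%:R + 1) / (2 * l%:R + 2) * incbeta l 1 :> R.
Proof. by rewrite /= semicircle1 exprS mul0r mulr0 mul0r addr0. Qed.

Lemma incbeta1_gt0 l : 0 < incbeta l 1 :> R.
Proof.
elim: l => [|l ih].
  have p0 : 0 < pi :> R := pi_gt0 R.
  rewrite /= /phi -[X in asin X](sin_pihalf R) sinK ?in_itv/=; lra.
by rewrite incbetaS1 mulr_gt0// divr_gt0// ltr_wpDl// mulr_ge0.
Qed.

Lemma int_semicircle m :
  \int[mu]_(x in `[-1, 1]) s x ^+ (2 * m).+1 = incbeta m.+1 1.
Proof.
have ds x : -1 < x < 1 -> is_derive x 1 (incbeta m.+1) (s x ^+ (2 * m).+1).
  move=> xI; apply: (derE (der_incbeta m.+1 xI)).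
  rewrite (_ : (2 * m.+1)%N = (2 * m).+2) ?mulnS//.
  by rewrite [X in X / _]exprSr mulfK// gt_eqF// semicircle_gt0.
rewrite (FTC_itv _ (@cts_incbeta m.+1) ds) ?incbetaN1 ?subr0//.
by apply: ctsXn; exact: cts_semicircle.
Qed.

Lemma fintE m : fint (m%:R + 2^-1) = incbeta m.+1 1 :> R.
Proof.
rewrite -int_semicircle /fint; apply: eq_Rintegral => x.
by rewrite inE /= in_itv/= => xI; rewrite powR_semicircle.
Qed.

End incomplete_beta.

Section gegenbauer_norms.
Context {R : realType}.
Let mu := @lebesgue_measure R.
Implicit Types (x : R) (l m n k : nat).
Local Notation s := (@semicircle R).
Local Notation W := (@gegW R).

Let cts_sX k : {within `[-1, 1], continuous (fun x => s x ^+ k)}.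
Proof. by apply: ctsXn; exact: cts_semicircle. Qed.

Definition eigval l n : R := n%:R * (n%:R + 2 * l%:R).

Lemma eigval_gt0 l n : 0 < eigval l n.+1.
Proof. by rewrite /eigval mulr_gt0// ltr_wpDr// mulr_ge0. Qed.

Lemma gegW_ode_horner l n x :
  (1 - x ^+ 2) * (W l n)^`()^`().[x] - (2 * l%:R + 1) * x * (W l n)^`().[x] +
  eigval l n * (W l n).[x] = 0.
Proof.
have /(congr1 (horner^~ x)) := gegW_ode (R := R) l n.
by rewrite !hornerE => <-; rewrite /eigval.
Qed.

(** The Gegenbauer equation in divergence form.  From here on the order is m.+1, so
    that the weight s ^ (2 m + 1) has a natural exponent without subtraction. *)
Lemma der_gegW_flux m n x : -1 < x < 1 ->
  is_derive x 1 (fun y => s y ^+ (2 * m).+3 * (W m.+1 n)^`().[y])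
    (- eigval m.+1 n * (s x ^+ (2 * m).+1 * (W m.+1 n).[x])).
Proof.
move=> xI; have s2 : s x ^+ 2 = 1 - x ^+ 2 by apply: semicircle_sqr; lra.
apply: (derE (derM (der_semicircleX (2 * m).+1 xI) (derH _ x))).
have := gegW_ode_horner m.+1 n x; rewrite -s2.
move: (W _ _).[x] (_^`()).[x] (_^`()^`()).[x] (eigval _ _) => w w' w'' e ode.
rewrite -[LHS]subr0 -[in LHS](mulr0 (s x ^+ (2 * m).+1)) -ode.
by rewrite !exprS -!natr1 natrM; ring.
Qed.

Lemma cts_poly_weight k (p : {poly R}) :
  {within `[-1, 1], continuous (fun x => s x ^+ k * p.[x])}.
Proof. by apply: ctsM; [exact: cts_sX | exact: ctsH]. Qed.

(** The integrand is a multiple of the derivative of the flux, which vanishes at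
    both endpoints. *)
Lemma int_gegW m n :
  \int[mu]_(x in `[-1, 1]) (s x ^+ (2 * m).+1 * (W m.+1 n.+1).[x]) = 0.
Proof.
have e0 := lt0r_neq0 (eigval_gt0 m.+1 n).
apply: (mulfI (x := - eigval m.+1 n.+1)); first by rewrite oppr_eq0.
rewrite mulr0 -RintZ; last exact: cts_poly_weight.
rewrite (FTC_itv _ _ (@der_gegW_flux m n.+1)); last exact: cts_poly_weight.
  by rewrite semicircle1 semicircleN1 exprS !mul0r subrr.
by apply: ctsM; [exact: ctsC | exact: cts_poly_weight].
Qed.

Definition gegnorm m n : R :=
  \int[mu]_(x in `[-1, 1]) (s x ^+ (2 * m).+1 * (W m.+1 n).[x] ^+ 2).

(** Integrating by parts moves one derivative of the Gegenbauer operator onto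
    the other factor; since the derivative of a Gegenbauer polynomial is one of
    the next order, this lowers the degree and raises the order. *)
Lemma gegnormS m n :
  gegnorm m n.+1 = n.+1%:R * (n.+1%:R + 2 * m.+1%:R) / (2 * m.+1%:R + 1) ^+ 2 *
                   gegnorm m.+1 n.
Proof.
set l := m.+1; have e0 := lt0r_neq0 (eigval_gt0 l n).
set c : R := eigval l n.+1 / (2 * l%:R + 1).
have W' x : (W l n.+1)^`().[x] = c * (W l.+1 n).[x].
  by rewrite deriv_gegW hornerZ.
have cW k p : {within `[-1, 1], continuous (fun x => s x ^+ k * p.[x] ^+ 2)}.
  by apply: ctsM; [exact: cts_sX | apply/ctsXn/ctsH].
have dG x : -1 < x < 1 -> is_derive x 1
    (fun y => (s y ^+ (2 * m).+3 * (W l n.+1)^`().[y]) * (W l n.+1).[y])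
    (c ^+ 2 * (s x ^+ (2 * l).+1 * (W l.+1 n).[x] ^+ 2) -
     eigval l n.+1 * (s x ^+ (2 * m).+1 * (W l n.+1).[x] ^+ 2)).
  move=> xI; apply: (derE (derM (der_gegW_flux m n.+1 xI) (derH _ x))).
  by rewrite W' /l mulnS; ring.
have cG : {within `[-1, 1], continuous
    (fun y => (s y ^+ (2 * m).+3 * (W l n.+1)^`().[y]) * (W l n.+1).[y])}.
  by apply: ctsM; [exact: cts_poly_weight | exact: ctsH].
have cZ c' k p : {within `[-1, 1], continuous (fun x => c' * (s x ^+ k * p.[x] ^+ 2))}.
  by apply: ctsM; [exact: ctsC | exact: cW].
have cf : {within `[-1, 1], continuous
    (fun x => c ^+ 2 * (s x ^+ (2 * l).+1 * (W l.+1 n).[x] ^+ 2) -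
       eigval l n.+1 * (s x ^+ (2 * m).+1 * (W l n.+1).[x] ^+ 2))}.
  by apply: ctsD; [|apply: ctsN]; exact: cZ.
have := FTC_itv cf cG dG.
rewrite semicircle1 semicircleN1 expr0n !mul0r subrr RintB; try exact: cZ.
rewrite !RintZ; try exact: cW.
rewrite -/(gegnorm m n.+1) -/(gegnorm l n) => /subr0_eq h.
apply: (mulfI e0); rewrite -h /c /eigval; field.
by rewrite gt_eqF// ltr_wpDl// mulr_ge0.
Qed.

End gegenbauer_norms.

Section harmonic_dimension.
Context {R : realType}.
Implicit Types (l n : nat).

(** The closed form N_n = (2 n + 2 L) (n + 2 L - 1)! / (n! (2 L)!) of the
    difference of binomials, here with L = l + 1 and without division. *)
Lemma harmonic_dim_fact l n :
  harmonic_dim R (2 * l.+1 + 2) n * n`!%:R * (2 * l.+1)`!%:R =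
  (n + (2 * l).+1)`!%:R * (2 * n%:R + 2 * l.+1%:R).
Proof.
rewrite /harmonic_dim (_ : (2 * l.+1 + 2)%N = (2 * l).+4); last by lia.
rewrite (_ : (2 * l.+1)%N = (2 * l).+2); last by lia.
rewrite (_ : (n + _ - 1)%N = (n + (2 * l).+3)%N); last by lia.
rewrite (_ : (n + _ - 3)%N = (n + (2 * l).+1)%N); last by lia.
set a := (2 * l)%N; have aE : a%:R = 2 * l%:R :> R by rewrite natrM.
have -> : 2 * l.+1%:R = a%:R + 2 :> R by rewrite aE -natr1; ring.
clear aE; clearbody a.
have bin k b : 'C(k + b, k)%:R * k`!%:R * b`!%:R = (k + b)`!%:R :> R.
  by rewrite -!natrM -mulnA -{2}[b](addKn k) bin_fact// leq_addr.
case: n => [|[|k]].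
- rewrite bin0 subr0 !mul1r add0n factS natrM mulrC mulr0 add0r.
  by rewrite -!natr1; ring.
- rewrite /= subr0 add1n bin1 (factS 0) fact0 mulr1 -!natr1 mulrC; congr (_ * _); ring.
have a3 : a%:R + 3 != 0 :> R by rewrite gt_eqF// ltr_wpDl.
apply: (mulIf a3); have h1 := bin k.+2 a.+3; have h2 := bin k a.+3.
rewrite /= (_ : (k.+2 - 2)%N = k); last by lia.
rewrite (_ : (k.+2 + a.+1)%N = (k + a.+3)%N); last by lia.
have F3 : a.+3`!%:R = (a%:R + 3) * a.+2`!%:R :> R.
  by rewrite factS natrM -!natr1; ring.
have Fk : k.+2`!%:R = (k%:R + 2) * (k%:R + 1) * k`!%:R :> R.
  by rewrite !factS !natrM -!natr1; ring.
have Fka : (k.+2 + a.+3)`!%:R =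
    (k%:R + a%:R + 5) * (k%:R + a%:R + 4) * (k + a.+3)`!%:R :> R.
  rewrite (_ : (k.+2 + a.+3)%N = (k + a.+3).+2); last by lia.
  rewrite !factS !natrM -!natr1 natrD -!natr1; ring.
rewrite F3 in h1 h2; rewrite {}Fka in h1; rewrite Fk in h1 *.
set P : R := 'C(_, _)%:R in h1 *; set Q : R := 'C(_, _)%:R in h2 *.
transitivity (P * ((k%:R + 2) * (k%:R + 1) * k`!%:R) * ((a%:R + 3) * a.+2`!%:R)
  - (k%:R + 2) * (k%:R + 1) * (Q * k`!%:R * ((a%:R + 3) * a.+2`!%:R))).
  by ring.
by rewrite h1 h2 -!natr1; ring.
Qed.

Lemma harmonic_dimS l n :
  harmonic_dim R (2 * l.+1 + 2) n.+1 * (n.+1%:R * (n.+1%:R + 2 * l.+1%:R)) =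
  (2 * l.+1%:R + 1) * (2 * l.+1%:R + 2) * harmonic_dim R (2 * l.+2 + 2) n.
Proof.
have f0 k : k`!%:R != 0 :> R by rewrite pnatr_eq0 -lt0n fact_gt0.
have := harmonic_dim_fact l n.+1; have := harmonic_dim_fact l.+1 n.
set P := harmonic_dim _ _ _; set Q := harmonic_dim _ _ _.
rewrite (_ : (2 * l.+2)%N = (2 * l.+1).+2); last by lia.
rewrite (_ : (n + (2 * l.+1).+1)%N = (n + (2 * l).+1).+2); last by lia.
rewrite (_ : (n.+1 + (2 * l).+1)%N = (n + (2 * l).+1).+1); last by lia.
have -> : 2 * l.+2%:R = (2 * l.+1)%:R + 2 :> R by rewrite natrM -!natr1; ring.
have -> : 2 * l.+1%:R = (2 * l.+1)%:R :> R by rewrite natrM.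
have : (n + (2 * l).+1)%:R = n%:R + (2 * l.+1)%:R - 1 :> R.
  by rewrite natrD -(natr1 (2 * l)) !natrM -(natr1 l); ring.
move: (2 * l.+1)%N (n + (2 * l).+1)%N => a b bE.
have F2 k : k.+2`!%:R = (k%:R + 2) * ((k%:R + 1) * k`!%:R) :> R.
  by rewrite !factS !natrM -!natr1; ring.
have F1 k : k.+1`!%:R = (k%:R + 1) * k`!%:R :> R.
  by rewrite !factS !natrM -!natr1; ring.
rewrite !F2 !F1 bE -(natr1 n) => hP hQ.
apply: (mulIf (f0 n)); apply: (mulIf (f0 a)).
transitivity ((n%:R + 1 + a%:R) * (Q * ((n%:R + 1) * n`!%:R) * a`!%:R)); first by ring.
rewrite hQ; transitivity (P * n`!%:R * ((a%:R + 2) * ((a%:R + 1) * a`!%:R))).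
  by rewrite hP; ring.
ring.
Qed.

Lemma harmonic_dim0 d : harmonic_dim R d 0 = 1.
Proof. by rewrite /harmonic_dim bin0 subr0. Qed.

End harmonic_dimension.

(** Induction on the degree, for all orders: the norm and the dimension in degree
    n + 1 are multiples of those in degree n for the next order, the total mass of
    the weight is a multiple of that for the next order, and the factors cancel. *)
Lemma gegnorm_dim {R : realType} m n :
  gegnorm m n * harmonic_dim R (2 * m.+1 + 2) n = incbeta m.+1 1 :> R.
Proof.
elim: n m => [|n ih] m.
  rewrite harmonic_dim0 mulr1 -int_semicircle; apply: eq_Rintegral => x _.
  by rewrite gegW0 hornerC expr1n mulr1.
have l0 : 0 <= m%:R :> R := ler0n _ _.
have := ih m.+1; rewrite gegnormS incbetaS1.
set P := harmonic_dim _ _ _; set Q := harmonic_dim _ _ _ => hP.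
have hQ : Q * (n.+1%:R * (n.+1%:R + 2 * m.+1%:R)) =
  (2 * m.+1%:R + 1) * (2 * m.+1%:R + 2) * P := harmonic_dimS m n.
transitivity (gegnorm m.+1 n * (Q * (n.+1%:R * (n.+1%:R + 2 * m.+1%:R))) /
  (2 * m.+1%:R + 1) ^+ 2).
  by ring.
have l1 : 2 * m.+1%:R + 1 != 0 :> R by rewrite gt_eqF// ltr_wpDl// mulr_ge0.
have l2 : 2 * m.+1%:R + 2 != 0 :> R by rewrite gt_eqF// ltr_wpDl// mulr_ge0.
rewrite hQ mulrCA hP; move: (m.+1%:R) l1 l2 => t l1 l2.
by field; rewrite l1 l2.
Qed.

(** * Double factorials in the coefficients *)

Section double_factorial_ratio.
Context {R : realType}.
Implicit Types (i j k l : nat).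

(** At i = 0 the truncated index 2 * 0 - 1 is 0, which is harmless since
    (-1)!! = 0!! = 1. *)
Definition dratio i : R := (dfact (2 * i - 1))%:R / (dfact (2 * i))%:R.

Lemma dfact_neq0 n : (dfact n)%:R != 0 :> R.
Proof.
rewrite pnatr_eq0 -lt0n; elim/ltn_ind: n => -[|[|n]] ih //=.
by rewrite muln_gt0 /= ih.
Qed.

Lemma dfact_odd i : dfact (2 * i).+1 = ((2 * i).+1 * dfact (2 * i - 1))%N.
Proof.
case: i => // i; rewrite (_ : (2 * i.+1)%N = (2 * i).+2); last by lia.
by rewrite subSS subn0.
Qed.

Lemma dratio0 : dratio 0 = 1.
Proof. by rewrite /dratio divr1. Qed.

Lemma dratioS i : (2 * i%:R + 2) * dratio i.+1 = (2 * i%:R + 1) * dratio i.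
Proof.
rewrite /dratio (_ : (2 * i.+1 - 1)%N = (2 * i).+1); last by lia.
rewrite (_ : (2 * i.+1)%N = (2 * i).+2); last by lia.
rewrite dfact_odd (_ : dfact _.+2 = (2 * i).+2 * dfact (2 * i))%N//.
rewrite !natrM -!natr1 natrM; field.
by rewrite dfact_neq0 /= gt_eqF// ltr_wpDl// mulr_ge0.
Qed.

Lemma dratio_neq0 i : dratio i != 0.
Proof. by rewrite mulf_neq0 ?invr_eq0 ?dfact_neq0. Qed.

Lemma dratio_inv k :
  (dfact (2 * k))%:R / (dfact (2 * k).+1)%:R = ((2 * k%:R + 1) * dratio k)^-1.
Proof.
rewrite dfact_odd natrM -natr1 natrM /dratio; field.
rewrite !dfact_neq0 /= gt_eqF// ltr_wpDl// mulr_ge0//.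
Qed.

Lemma c_coefE l i : c_coef R l i.+1 = dratio i / (2 * l%:R).
Proof.
rewrite /c_coef (_ : (2 * i.+1 - 1)%N = (2 * i).+1); last by lia.
rewrite (_ : (2 * i.+1 - 2)%N = (2 * i)%N); last by lia.
rewrite dfact_odd (natrM _ (2 * i).+1) natrM.
have i0 : (2 * i).+1%:R != 0 :> R by rewrite pnatr_eq0.
by rewrite /dratio -mulrA [X in _ * X]mulrA mulKf// mulrC.
Qed.

(** The two products of double factorials are the ratios for l and for
    k = l - 1 - j, with j = i + 1.  In the derivative of the closed form, the second
    part cancels against [c_coefE]. *)
Lemma d_coefE l i k : l = (i.+2 + k)%N ->
  d_coef R l i.+1 = (2 * i%:R + 2)^-1 *
   (dratio l / ((2 * k%:R + 1) * dratio k) - dratio i.+1 / (2 * l%:R)).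
Proof.
move=> lE; rewrite /d_coef.
rewrite (_ : (2 * l - 2 * i.+1 - 1)%N = (2 * k).+1); last by lia.
rewrite (_ : (2 * l - 2 * i.+1 - 2)%N = (2 * k)%N); last by lia.
rewrite (_ : (2 * i.+1)%:R = 2 * i%:R + 2 :> R); last first.
  by rewrite natrM -natr1; ring.
rewrite -dratio_inv natrM /dratio; congr (_ * (_ - _)); first by ring.
by rewrite mulrC.
Qed.

End double_factorial_ratio.

(** * The derivative of the closed form *)

Section spline_derivative.
Context {R : realType}.
Implicit Types (x : R) (i k m : nat).
Local Notation s := (@semicircle R).
Local Notation a := (@dratio R).

Lemma derV (f : R -> R) x b : is_derive x 1 f b -> f x != 0 ->
  is_derive x 1 (fun y => (f y)^-1) (- b / f x ^+ 2).
Proof.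
move=> df fx0; have := is_deriveV fx0 df.
by move/derE; apply; rewrite /GRing.scale/= mulNr mulrC mulNr.
Qed.

Lemma der_semicircleV k x : -1 < x < 1 ->
  is_derive x 1 (fun y => (s y ^+ k)^-1) (k%:R * x / s x ^+ k.+2).
Proof.
move=> xI; have s0 := semicircle_gt0 xI; have sn0 := lt0r_neq0 s0.
case: k => [|k].
  rewrite !mul0r (_ : (fun _ => _) = fun=> 1); first exact: derC.
  by apply/funext => y; rewrite expr0 invr1.
have sk0 : s x ^+ k.+1 != 0 by rewrite expf_neq0.
apply: (derE (derV (derXn k (der_semicircle xI)) sk0)).
by rewrite !exprS; field; rewrite sn0 expf_neq0.
Qed.

Definition polesum k x : R := \sum_(0 <= i < k) a i * (x / s x ^+ (2 * i).+1).

(** The derivative of x / s ^ (2 i + 1) is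
    (2 i + 1) / s ^ (2 i + 3) - 2 i / s ^ (2 i + 1), and the recursion of the
    coefficients makes the sum of these telescope to its last term. *)
Lemma der_polesum k x : -1 < x < 1 ->
  is_derive x 1 (polesum k) (2 * k%:R * a k / s x ^+ (2 * k).+1).
Proof.
move=> xI; have s0 := semicircle_gt0 xI; have sn0 := lt0r_neq0 s0.
have s2 : s x ^+ 2 = 1 - x ^+ 2 by apply: semicircle_sqr; lra.
elim: k => [|k ih].
  rewrite mulr0 !mul0r (_ : polesum 0 = fun=> 0); first exact: derC.
  by apply/funext => y; rewrite /polesum big_geq.
rewrite (_ : polesum k.+1 =
    fun y => polesum k y + a k * (y * (s y ^+ (2 * k).+1)^-1)); last first.
  by apply/funext => y; rewrite /polesum big_nat_recr.
apply: (derE (derD ih (derZ (a k) (derM (derX x) (der_semicircleV (2 * k).+1 xI))))).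
rewrite (_ : 2 * k.+1%:R * a k.+1 = (2 * k%:R + 1) * a k); last first.
  by rewrite -dratioS -natr1; ring.
rewrite (_ : (2 * k.+1)%N = (2 * k).+2); last by lia.
have -> : x * ((2 * k).+1%:R * x / s x ^+ (2 * k).+3) =
   (2 * k).+1%:R * (x ^+ 2) / s x ^+ (2 * k).+3 by ring.
have -> : x ^+ 2 = 1 - s x ^+ 2 by rewrite s2; ring.
rewrite -(natr1 (2 * k)) natrM (exprD _ 2 (2 * k).+1 : s x ^+ (2 * k).+3 = _).
have := expf_neq0 (2 * k).+1 sn0; move: (s x ^+ (2 * k).+1) => P P0.
by field; rewrite sn0 P0.
Qed.

(** The reduction formula, unfolded. *)
Lemma incbeta_sum l x : incbeta l x =
  a l * (phi x + x * \sum_(0 <= k < l) s x ^+ (2 * k).+1 / ((2 * k%:R + 1) * a k)).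
Proof.
elim: l => [|k ih]; first by rewrite big_geq// mulr0 addr0 dratio0 mul1r.
rewrite big_nat_recr//= ih.
have k1 : 2 * k%:R + 1 != 0 :> R by rewrite gt_eqF// ltr_wpDl// mulr_ge0.
have k2 : 2 * k%:R + 2 != 0 :> R by rewrite gt_eqF// ltr_wpDl// mulr_ge0.
have -> : a k.+1 = (2 * k%:R + 1) * a k / (2 * k%:R + 2).
  by rewrite -dratioS mulrAC mulfV// mul1r.
by field; rewrite dratio_neq0 k1.
Qed.

(** The closed form, with all powers of 1 - x ^ 2 written as powers of s. *)
Definition spline m x : R :=
  phi x * ((2 * m.+1%:R)^-1 * polesum m.+1 x) +
  \sum_(0 <= i < m) d_coef R m.+1 i.+1 * (s x ^+ (2 * i).+2)^-1 - C_const R m.+1.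

(** Differentiating [polesum] leaves the arcsine term of [incbeta_sum] and
    differentiating phi leaves a sum of poles; this sum and the derivative of the
    second sum together match the algebraic terms of [incbeta_sum], listed in
    the reverse order. *)
Lemma der_spline m x : -1 < x < 1 ->
  is_derive x 1 (spline m) (incbeta m.+1 x / s x ^+ (2 * m).+3).
Proof.
move=> xI; have s0 := semicircle_gt0 xI; have sn0 := lt0r_neq0 s0.
have ds i := derZ (d_coef R m.+1 i.+1) (der_semicircleV (2 * i).+2 xI).
apply: (derE (derD (derD (derM (der_phi xI) (derZ _ (der_polesum m.+1 xI)))
  (der_sum (index_iota 0 m) ds)) (derN (derC _ x)))).
have l0 : m.+1%:R != 0 :> R by rewrite pnatr_eq0.
rewrite incbeta_sum oppr0 addr0 [in RHS]mulrDr [in RHS]mulrDl.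
rewrite [X in X + _ = _]addrC -addrA; congr (_ + _).
  rewrite (_ : (2 * m.+1).+1 = (2 * m).+3); last by lia.
  by field; rewrite expf_neq0//= gt_eqF// ltr_wpDr.
rewrite /polesum big_nat_recl// [in RHS]big_nat_recr//= [in RHS]mulrDr.
rewrite dratio0 mul1r muln0 expr1 [in RHS]big_nat_rev/= add0n.
rewrite !mulrDr -addrA [RHS]mulrDl [RHS]addrC.
have m1 : 2 * m%:R + 1 != 0 :> R by rewrite gt_eqF// ltr_wpDl// mulr_ge0.
have al : a m.+1 = (2 * m%:R + 1) * a m / (2 * m.+1%:R).
  by rewrite -dratioS -natr1; field; rewrite gt_eqF// ltr_wpDr.
have sD k : s x ^+ (k + 2) = s x ^+ k * s x ^+ 2 by rewrite exprD.
(* the pole of order 2 comes from [polesum] alone *)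
congr (_ + _).
  rewrite al (_ : (2 * m).+3 = ((2 * m).+1 + 2)%N); last by lia.
  rewrite sD; have := expf_neq0 (2 * m).+1 sn0.
  move: (s x ^+ (2 * m).+1) (m.+1%:R) l0 => P t t0 P0.
  by field; rewrite sn0 P0 m1 t0 dratio_neq0.
rewrite !(mulr_sumr, mulr_suml) -big_split; apply: eq_big_nat => i /andP[_ im].
set k := (m - i.+1)%N; have mE : m.+1 = (i.+2 + k)%N by lia.
rewrite /= (d_coefE mE) (_ : (2 * m).+3 = ((2 * k).+1 + (2 * i).+4)%N); last by lia.
rewrite exprD (_ : (2 * i.+1).+1 = (2 * i).+3); last by lia.
rewrite (_ : (2 * i).+2%:R = 2 * i%:R + 2 :> R); last first.
  by rewrite -!natr1 natrM; ring.
rewrite (exprS _ (2 * i).+3).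
have i2 : 2 * i%:R + 2 != 0 :> R by rewrite gt_eqF// ltr_wpDl// mulr_ge0.
have k1 : 2 * k%:R + 1 != 0 :> R by rewrite gt_eqF// ltr_wpDl// mulr_ge0.
have := dratio_neq0 (R := R) k; move: (a k) (a i.+1) (a m.+1) => ak ai am ak0.
have := expf_neq0 (2 * k).+1 sn0; have := expf_neq0 (2 * i).+3 sn0.
move: (s x ^+ (2 * k).+1) (s x ^+ (2 * i).+3) => P Q Q0 P0.
move: (m.+1%:R) l0 (2 * i%:R + 2) i2 (2 * k%:R + 1) k1 => t t0 u u0 v v0.
by field; rewrite sn0 P0 Q0 ak0 u0 v0 t0.
Qed.

End spline_derivative.

(** * Pairings of the closed form with the Gegenbauer polynomials *)

Section spline_pairings.
Context {R : realType}.
Let mu := @lebesgue_measure R.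
Implicit Types (x : R) (i k m n : nat).
Local Notation s := (@semicircle R).
Local Notation W := (@gegW R).

(** The product of the closed form and the weight: its singularities at the
    endpoints cancel, and it is continuous on [-1, 1]. *)
Definition splineW m x : R :=
  (2 * m.+1%:R)^-1 *
    (\sum_(0 <= i < m.+1) dratio i * (phi x * x * s x ^+ (2 * (m - i)))) +
  \sum_(0 <= i < m) d_coef R m.+1 i.+1 * s x ^+ (2 * (m - i.+1)).+1
  - C_const R m.+1 * s x ^+ (2 * m).+1.

Lemma splineWE m x : -1 < x < 1 -> splineW m x = spline m x * s x ^+ (2 * m).+1.
Proof.
move=> xI; have sn0 := lt0r_neq0 (semicircle_gt0 xI).
rewrite /spline /splineW [RHS]mulrDl [X in _ = X + _]mulrDl [X in _ = _ + X]mulNr.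
congr (_ + _ - _).
  rewrite /polesum mulrCA -[RHS]mulrA; congr (_ * _).
  rewrite mulr_sumr mulr_suml; apply: eq_big_nat => i /andP[_ im].
  rewrite [in RHS](_ : (2 * m).+1 = (2 * (m - i) + (2 * i).+1)%N); last by lia.
  by rewrite exprD; field; rewrite expf_neq0.
rewrite mulr_suml; apply: eq_big_nat => i /andP[_ im].
rewrite [in RHS](_ : (2 * m).+1 = ((2 * (m - i.+1)).+1 + (2 * i).+2)%N); last by lia.
by rewrite exprD; field; rewrite expf_neq0.
Qed.

Let cts_sX k : {within `[-1, 1], continuous (fun x => s x ^+ k)}.
Proof. by apply: ctsXn; exact: cts_semicircle. Qed.

Let cts_phis k : {within `[-1, 1], continuous (fun x => phi x * x * s x ^+ k)}.
Proof.
apply: ctsM; last exact: cts_sX.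
by apply: ctsM; [exact: cts_phi | exact: cts_id].
Qed.

Lemma cts_splineW m : {within `[-1, 1], continuous (splineW m)}.
Proof.
apply: ctsD; first apply: ctsD.
- apply: ctsM; [exact: ctsC|apply: cts_sum => i].
  by apply: ctsM; [exact: ctsC | exact: cts_phis].
- by apply: cts_sum => i; apply: ctsM; [exact: ctsC | exact: cts_sX].
- by apply: ctsN; apply: ctsM; [exact: ctsC | exact: cts_sX].
Qed.

(** Integration by parts against the primitive - s ^ (2 k + 2) / (2 k + 2) of
    x s ^ (2 k). *)
Lemma int_phi k : \int[mu]_(x in `[-1, 1]) (phi x * x * s x ^+ (2 * k)) =
  (2 * k%:R + 2)^-1 * incbeta k.+1 1.
Proof.
have k2 : 2 * k%:R + 2 != 0 :> R by rewrite gt_eqF// ltr_wpDl// mulr_ge0.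
have dF x : -1 < x < 1 -> is_derive x 1
    (fun y => - (2 * k%:R + 2)^-1 * (phi y * s y ^+ (2 * k).+2))
    (phi x * x * s x ^+ (2 * k) - (2 * k%:R + 2)^-1 * s x ^+ (2 * k).+1).
  move=> xI; have sn0 := lt0r_neq0 (semicircle_gt0 xI).
  apply: (derE (derZ _ (derM (der_phi xI) (der_semicircleX (2 * k) xI)))).
  rewrite (exprS _ (2 * k).+1) -(natr1 (2 * k).+1) -(natr1 (2 * k)) natrM.
  by field; rewrite sn0 k2.
have cf : {within `[-1, 1], continuous
    (fun x => phi x * x * s x ^+ (2 * k) - (2 * k%:R + 2)^-1 * s x ^+ (2 * k).+1)}.
  apply: ctsD; first exact: cts_phis.
  by apply: ctsN; apply: ctsM; [exact: ctsC | exact: cts_sX].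
have cF : {within `[-1, 1], continuous
    (fun y => - (2 * k%:R + 2)^-1 * (phi y * s y ^+ (2 * k).+2))}.
  apply: ctsM; first exact: ctsC.
  by apply: ctsM; [exact: cts_phi | exact: cts_sX].
have := FTC_itv cf cF dF.
rewrite semicircle1 semicircleN1 expr0n !mulr0 subrr RintB; first last.
- by apply: ctsM; [exact: ctsC | exact: cts_sX].
- exact: cts_phis.
by move/subr0_eq => ->; rewrite RintZ ?int_semicircle.
Qed.

(** The constant [C_const] is, by definition, the weighted mean of the other
    terms, once [int_phi] is applied. *)
Lemma int_splineW m : \int[mu]_(x in `[-1, 1]) splineW m x = 0.
Proof.
have cd i : {within `[-1, 1], continuous
    (fun x => d_coef R m.+1 i.+1 * s x ^+ (2 * (m - i.+1)).+1)}.
  by apply: ctsM; [exact: ctsC | exact: cts_sX].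
have cp i : {within `[-1, 1], continuous
    (fun x => dratio i * (phi x * x * s x ^+ (2 * (m - i))))}.
  by apply: ctsM; [exact: ctsC | exact: cts_phis].
rewrite /splineW RintB; first last.
- by apply: ctsM; [exact: ctsC | exact: cts_sX].
- apply: ctsD; last exact: cts_sum.
  by apply: ctsM; [exact: ctsC | exact: cts_sum].
rewrite RintD; first last.
- exact: cts_sum.
- by apply: ctsM; [exact: ctsC | exact: cts_sum].
rewrite 2?RintZ ?Rint_sum//; last exact: cts_sum.
rewrite int_semicircle /C_const.
have -> : m.+1%:R - 2^-1 = m%:R + 2^-1 :> R by rewrite -natr1; field.
rewrite fintE; have /lt0r_neq0 := incbeta1_gt0 (R := R) m.+1.
move: (incbeta m.+1 1) => A A0; rewrite mulrAC mulVf// mul1r.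
apply/eqP; rewrite subr_eq0; apply/eqP.
rewrite [in RHS]big_add1 [X in _ = _ + X]big_add1/=; congr (_ + _).
  rewrite mulr_sumr; apply: eq_big_nat => i /andP[_ im].
  rewrite RintZ// int_phi c_coefE.
  have -> : m.+1%:R - i.+1%:R + 2^-1 = (m - i)%:R + 2^-1 :> R.
    by rewrite natrB// -!natr1; ring.
  have -> : m.+1%:R - i.+1%:R + 1 = (m - i)%:R + 1 :> R.
    by rewrite natrB// -!natr1; ring.
  have -> : 2 * ((m - i)%:R + 1) = 2 * (m - i)%:R + 2 :> R by ring.
  by rewrite fintE; ring.
apply: eq_big_nat => i /andP[_ im]; rewrite RintZ// int_semicircle.
have -> : m.+1%:R - i.+1%:R - 2^-1 = (m - i.+1)%:R + 2^-1 :> R.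
  by rewrite natrB// -!natr1; field.
by rewrite fintE.
Qed.

(** Green's formula: the Gegenbauer operator maps the polynomial to a multiple of
    itself and the closed form to a constant, to which the polynomial is
    orthogonal, so only boundary terms are left; the sole nonzero one is the
    value of [incbeta] at 1. *)
Lemma int_splineW_gegW m n :
  eigval m.+1 n.+1 * \int[mu]_(x in `[-1, 1]) (splineW m x * (W m.+1 n.+1).[x])
  = incbeta m.+1 1.
Proof.
set p := W m.+1 n.+1; set e := eigval _ _.
(* G is the boundary term, in a form that is continuous up to the endpoints;
   on the open interval it agrees with G' below *)
pose G y := - (s y ^+ 2 * splineW m y * p^`().[y]) + incbeta m.+1 y * p.[y].
have dG x : -1 < x < 1 -> is_derive x 1 G
    (e * (splineW m x * p.[x]) + s x ^+ (2 * m).+1 * p.[x]).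
  move=> xI; have sn0 := lt0r_neq0 (semicircle_gt0 xI).
  pose G' y := - (s y ^+ (2 * m).+3 * p^`().[y] * spline m y) + incbeta m.+1 y * p.[y].
  have dG' : is_derive x 1 G' (e * (splineW m x * p.[x]) + s x ^+ (2 * m).+1 * p.[x]).
    apply: (derE (derD (derN (derM (der_gegW_flux m n.+1 xI) (der_spline m xI)))
      (derM (der_incbeta m.+1 xI) (derH p x)))).
    rewrite splineWE// (_ : (2 * m.+1)%N = (2 * m).+2); last by lia.
    rewrite -/e -/p (exprS _ (2 * m).+1).
    by field; rewrite expf_neq0 ?sn0.
  apply: near_eq_is_derive dG'; near=> y.
  have yI : -1 < y < 1 by near: y; exact: near_in_itvoo.
  by rewrite /G /G' splineWE// (exprD _ 2 (2 * m).+1 : s y ^+ (2 * m).+3 = _); ring.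
have cG : {within `[-1, 1], continuous G}.
  apply: ctsD; last by apply: ctsM; [exact: cts_incbeta | exact: ctsH].
  apply/ctsN/ctsM; last exact: ctsH.
  by apply: ctsM; [exact: cts_sX | exact: cts_splineW].
have cSW : {within `[-1, 1], continuous (fun x => splineW m x * p.[x])}.
  by apply: ctsM; [exact: cts_splineW | exact: ctsH].
have := FTC_itv _ cG dG; rewrite RintD; first last.
- exact: cts_poly_weight.
- by apply: ctsM; [exact: ctsC | exact: cSW].
rewrite RintZ// int_gegW addr0 => ->; last first.
  by apply: ctsD; [apply: ctsM; [exact: ctsC | exact: cSW] | exact: cts_poly_weight].
rewrite /G semicircle1 semicircleN1 incbetaN1 gegW_at1 expr0n !mul0r.
by rewrite !oppr0 !add0r subr0 mulr1.
Unshelve. all: by end_near. Qed.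

End spline_pairings.

(** * Existence of the spline *)

Section thinplate_existence.
Context {R : realType}.
Implicit Types (x : R) (m n : nat).
Local Notation s := (@semicircle R).
Local Notation W := (@gegW R).

(** On ]-1, 0] the weight increases, so its integral over [-1, x] is at most
    (1 + x) s ^ (2 m + 1), and 1 + x is at most s ^ 2. *)
Lemma incbeta_bounds m x : -1 < x <= 0 ->
  0 <= incbeta m.+1 x <= s x ^+ (2 * m).+3.
Proof.
move=> xI; have Nx : -1 < x by lra.
have cB : {within `[-1, x], continuous (incbeta m.+1)}.
  apply: continuous_subspaceW (@cts_incbeta R m.+1) => y /=.
  by rewrite !in_itv/=; lra.
have dB c : c \in `]-1, x[ ->
    is_derive c 1 (incbeta m.+1) (s c ^+ (2 * m.+1) / s c).
  rewrite in_itv/= => cI; have cI' : -1 < c < 1 by lra.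
  exact: (der_incbeta m.+1 cI').
have [c] := MVT Nx dB cB.
rewrite incbetaN1 subr0 opprK in_itv => /andP[/= c1 c2] ->.
have sc0 : 0 < s c by apply: semicircle_gt0; lra.
have sx0 : 0 < s x by apply: semicircle_gt0; lra.
have -> : s c ^+ (2 * m.+1) / s c = s c ^+ (2 * m).+1.
  rewrite (_ : (2 * m.+1)%N = (2 * m).+2); last by lia.
  by rewrite [X in X / _]exprSr mulfK// gt_eqF.
apply/andP; split; first by rewrite mulr_ge0 ?exprn_ge0 ?(ltW sc0)//; lra.
have sx2 : s x ^+ 2 = 1 - x ^+ 2 by apply: semicircle_sqr; lra.
have scx : s c <= s x by rewrite ler_sqrt; nra.
rewrite (_ : (2 * m).+3 = ((2 * m).+1 + 2)%N); last by lia.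
rewrite exprD ler_pM//.
- by rewrite exprn_ge0// ltW.
- by lra.
- by rewrite lerXn2r// nnegrE ltW.
- by rewrite sx2; nra.
Qed.

Lemma spline_increment m x y : -1 < x -> x < y -> y <= 0 ->
  0 <= spline m y - spline m x <= y - x.
Proof.
move=> Nx xy y0.
have dS c : c \in `]x, y[ -> is_derive c 1 (spline m)
    (incbeta m.+1 c / s c ^+ (2 * m).+3).
  rewrite in_itv/= => cI; have cI' : -1 < c < 1 by lra.
  exact: (der_spline m cI').
have cS : {within `[x, y], continuous (spline m)}.
  apply: derivable_within_continuous => c; rewrite in_itv/= => cI.
  have cI' : -1 < c < 1 by lra.
  by have [] := der_spline m cI'.
have [c] := MVT xy dS cS; rewrite in_itv/= => cI ->.
have c0 : -1 < c <= 0 by lra.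
have /andP[B0 B1] := incbeta_bounds m c0.
have sc0 : 0 < s c ^+ (2 * m).+3 by rewrite exprn_gt0// semicircle_gt0//; lra.
rewrite mulr_ge0 ?divr_ge0 ?(ltW sc0)//=; last by lra.
by rewrite ler_piMl//; [lra|rewrite ler_pdivrMr// mul1r].
Qed.

(** The closed form is nondecreasing and 1-Lipschitz near -1. *)
Lemma cvg_spline m : exists L : R, spline m x @[x --> (-1)^'+] --> L.
Proof.
eexists; apply: (@nondecreasing_at_right_cvgr _ _ (-1) (BRight 0)).
- by rewrite bnd_simp; lra.
- move=> x y; rewrite !in_itv/= => xI yI; rewrite le_eqVlt => /predU1P[->//|xy].
  have := @spline_increment m x y; lra.
- exists (spline m 0 - 1) => _ /= [x + <-]; rewrite in_itv/= => xI.
  have [->|x0] := eqVneq x 0; first by lra.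
  have := @spline_increment m x 0; have : x < 0 by lra.
  lra.
Qed.

Definition spline_ext m (L : R) x : R := if x == -1 then L else spline m x.

Lemma cts_spline m x : -1 < x < 1 -> {for x, continuous (spline m)}.
Proof.
move=> xI; apply: differentiable_continuous; apply/derivable1_diffP.
by have [] := der_spline m xI.
Qed.

Lemma cts_spline_ext m L : spline m x @[x --> (-1)^'+] --> L ->
  {within `[-1, 1[, continuous (spline_ext m L)}.
Proof.
move=> SL; apply/subspace_continuousP => x /=; rewrite in_itv/= => xI.
have [xN1|xN1] := eqVneq x (-1).
  have eL : spline_ext m L (-1) = L by rewrite /spline_ext eqxx.
  have : spline_ext m L y @[y --> (-1)^'+] --> spline_ext m L (-1).
    rewrite eL; apply: cvg_trans SL; apply: near_eq_cvg; near=> y.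
    by rewrite /spline_ext gt_eqF//; near: y; exact: nbhs_right_gt.
  move=> /cvg_at_right_within; rewrite xN1; apply: cvg_trans; apply: cvg_app.
  by apply: within_subset => y /=; rewrite in_itv/= => /andP[].
have xI' : -1 < x < 1.
  by case/andP: xI => x1 ->; rewrite andbT lt_neqAle eq_sym xN1.
have eL : spline_ext m L x = spline m x by rewrite /spline_ext (negbTE xN1).
have h : spline_ext m L y @[y --> x] --> spline m x.
  apply: cvg_trans (cts_spline (m := m) xI'); apply: near_eq_cvg; near=> y.
  have : -1 < y < 1 by near: y; exact: near_in_itvoo.
  by move=> /andP[yN1 _]; rewrite /spline_ext gt_eqF.
by rewrite -eL in h; exact: cvg_within_filter h.
Unshelve. all: by end_near. Qed.

End thinplate_existence.

Section thinplate_spline.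
Context {R : realType}.
Let mu := @lebesgue_measure R.
Implicit Types (x : R) (m n : nat) (k : R -> R).
Local Notation s := (@semicircle R).
Local Notation W := (@gegW R).

Lemma sphere_lambdaE m : sphere_lambda R (2 * m.+1 + 2) = m.+1%:R.
Proof. by rewrite /sphere_lambda natrD natrM; field. Qed.

Lemma gegenbauer_ipE m k n :
  gegenbauer_ip m.+1%:R k (gegenbauerW m.+1%:R n) =
  \int[mu]_(x in `[-1, 1]) (k x * s x ^+ (2 * m).+1 * (W m.+1 n).[x]).
Proof.
apply: eq_Rintegral => x; rewrite inE/= in_itv/= => xI.
rewrite gegenbauerWE gegenbauer_weightE// mulrAC.
by rewrite (_ : (2 * m.+1).-1 = (2 * m).+1)//; lia.
Qed.

Lemma gegenbauer_ip_norm m n :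
  gegenbauer_ip m.+1%:R (gegenbauerW m.+1%:R n) (gegenbauerW m.+1%:R n) =
  gegnorm m n :> R.
Proof.
rewrite gegenbauer_ipE; apply: eq_Rintegral => x _.
by rewrite gegenbauerWE; ring.
Qed.

Lemma gegnorm_neq0 m n : gegnorm m n != 0 :> R.
Proof.
have := incbeta1_gt0 (R := R) m.+1; rewrite -(gegnorm_dim m n).
by apply: contraTneq => ->; rewrite mul0r ltxx.
Qed.

Lemma spline_ip m k n : {in `]-1, 1[, k =1 spline m} ->
  gegenbauer_ip m.+1%:R k (gegenbauerW m.+1%:R n) =
  \int[mu]_(x in `[-1, 1]) (splineW m x * (W m.+1 n).[x]).
Proof.
move=> kS; rewrite gegenbauer_ipE; apply: eq_Rintegral_oo.
  by move=> x xI; rewrite kS// splineWE//; rewrite in_itv in xI.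
by apply: ctsM; [exact: cts_splineW | exact: ctsH].
Qed.

(** Dividing the pairings of [int_splineW_gegW] by the norms leaves the dimensions
    over the eigenvalues, by [gegnorm_dim]. *)
Lemma spline_thinplate m k : {in `]-1, 1[, k =1 spline m} ->
  {within `[-1, 1[, continuous k} -> is_thinplate_spline (2 * m.+1 + 2) k.
Proof.
move=> kS ck; rewrite /is_thinplate_spline sphere_lambdaE; split => //.
- have := @integrable_oo R (fun x => k x * gegenbauer_weight m.+1%:R x) (splineW m).
  apply; last exact: cts_splineW.
  move=> x xI; rewrite kS//; move: xI; rewrite in_itv/= => xI.
  rewrite splineWE// gegenbauer_weightE//; last by lra.
  by rewrite (_ : (2 * m.+1).-1 = (2 * m).+1)//; lia.
- rewrite (spline_ip _ kS) -[RHS](int_splineW m); apply: eq_Rintegral => x _.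
  by rewrite gegW0 hornerC mulr1.
- case=> // n _; rewrite (spline_ip _ kS) gegenbauer_ip_norm.
  have e0 := lt0r_neq0 (eigval_gt0 (R := R) m.+1 n).
  have := int_splineW_gegW (R := R) m n; rewrite -(gegnorm_dim m n.+1) => h.
  apply: (mulfI e0); rewrite mulrA h mulrAC mulfV ?gegnorm_neq0// mul1r.
  rewrite mulrA (_ : n.+1%:R + _ - 2 = n.+1%:R + 2 * m.+1%:R) ?mulfV ?mul1r//.
  by rewrite natrD natrM; ring.
Qed.

End thinplate_spline.

(** * Uniqueness of the spline *)

Section moments_determine.
Context {R : realType}.
Let mu := @lebesgue_measure R.
Implicit Types (v h : R -> R) (x : R) (p : {poly R}).

Lemma integrableM_cts v h : mu.-integrable `[-1, 1] (EFin \o v) ->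
  {within `[-1, 1], continuous h} ->
  mu.-integrable `[-1, 1] (EFin \o (fun x => v x * h x)).
Proof.
move=> iv ch; have /integrableP[/measurable_EFinP mh _] := cts_integrable ch.
have bh : [bounded h x | x in `[-1, 1]%classic].
  have cI : compact `[-1 : R, 1] by exact: segment_compact.
  have /compact_bounded[M [_ hM]] := continuous_compact ch cI.
  by exists M; split; rewrite ?num_real // => y My z zI; apply: (hM y) => //; exists z.
have : mu.-integrable `[-1, 1] ((EFin \o v) \* (EFin \o h))%E by exact: integrableMl.
by apply: eq_integrable => // x _; rewrite /= EFinM.
Qed.

Lemma integrableZ v (a : R) : mu.-integrable `[-1, 1] (EFin \o v) ->
  mu.-integrable `[-1, 1] (EFin \o (fun x => a * v x)).
Proof.
move=> iv.
have : mu.-integrable `[-1, 1] (fun x => a%:E * (EFin \o v) x)%E by exact: integrableZl.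
by apply: eq_integrable => // x _; rewrite /= EFinM.
Qed.

Lemma integrableB_fin v h : mu.-integrable `[-1, 1] (EFin \o v) ->
  mu.-integrable `[-1, 1] (EFin \o h) ->
  mu.-integrable `[-1, 1] (EFin \o (fun x => v x - h x)).
Proof.
move=> iv ih; have : mu.-integrable `[-1, 1] ((EFin \o v) \- (EFin \o h))%E.
  exact: integrableB.
by apply: eq_integrable => // x _; rewrite /= EFinB.
Qed.

(** The base of the power is at most 1 beyond distance r of x0, at least 1 within
    distance r, and at least 1 + 3 r ^ 2 / 16 within distance r / 2, where
    Bernoulli's inequality applies. *)
Lemma peak_power v (x0 r d : R) N :
  0 < r -> 0 < d -> (forall x, `|x - x0| <= r -> d <= v x) ->
  -1 < x0 < 1 -> forall x, -1 <= x <= 1 ->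
  d * (1 + (3 * r ^+ 2 / 16) * N%:R) * \1_`[x0 - r / 2, x0 + r / 2] x - `|v x| <=
  v x * (1 + (r ^+ 2 - (x - x0) ^+ 2) / 4) ^+ N.
Proof.
move=> r0 d0 vd x0I x xI; set q := 1 + _ / 4.
have sq : (x - x0) ^+ 2 < 4 by nra.
have q0 : 0 < q by rewrite /q; nra.
have qN0 : 0 <= q ^+ N by rewrite exprn_ge0// ltW.
have [xr|xr] := leP `|x - x0| r; last first.
  have xJ : x \notin `[x0 - r / 2, x0 + r / 2]%classic.
    apply/negP; rewrite inE/= in_itv/= => h; move: xr; apply/negP; rewrite -leNgt.
    by rewrite ler_norml; lra.
  rewrite indicE (negbTE xJ) mulr0 add0r.
  have q1 : q <= 1.
    have : r ^+ 2 <= (x - x0) ^+ 2.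
      rewrite -[leRHS]real_normK ?num_real// lerXn2r// ?nnegrE ?ltW//.
    by rewrite /q; lra.
  have qN1 : q ^+ N <= 1 by rewrite exprn_ile1// ltW.
  rewrite -[leRHS]opprK lerN2 -mulNr (le_trans (ler_norm _))// normrM normrN.
  by rewrite (ger0_norm qN0) ler_piMr.
have vx := vd x xr; have vx0 : 0 < v x by lra.
rewrite gtr0_norm// indicE; case: (boolP (x \in _)) => [|_]; last first.
  rewrite mulr0 add0r; apply: (@le_trans _ _ 0); first by rewrite oppr_le0 ltW.
  by rewrite mulr_ge0// ltW.
rewrite inE/= in_itv/= => xJ; rewrite mulr1.
have qc : 1 + 3 * r ^+ 2 / 16 <= q.
  have : (x - x0) ^+ 2 <= (r / 2) ^+ 2 by nra.
  by rewrite /q; nra.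
have c0 : 0 <= 3 * r ^+ 2 / 16 by nra.
have bern : 1 + (3 * r ^+ 2 / 16) * N%:R <= q ^+ N.
  apply: le_trans (_ : (1 + 3 * r ^+ 2 / 16) ^+ N <= _); last first.
    by rewrite lerXn2r// nnegrE; lra.
  elim: N {qN0} => [|N ih]; first by rewrite mulr0 addr0 expr0.
  move: (3 * r ^+ 2 / 16) c0 ih => c c0 ih; rewrite exprS.
  apply: le_trans (_ : (1 + c) * (1 + c * N%:R) <= _); last first.
    by rewrite ler_wpM2l// addr_ge0.
  rewrite -natr1; have : 0 <= c * c * N%:R by rewrite !mulr_ge0.
  by lra.
apply: (@le_trans _ _ (d * (1 + 3 * r ^+ 2 / 16 * N%:R))).
  by rewrite gerBl ltW.
by apply: ler_pM => //; [exact: ltW | rewrite addr_ge0// mulr_ge0].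
Qed.

(** Against the powers of a polynomial that exceeds 1 only near a point where v
    is positive, the integral of v would tend to infinity ([peak_power]). *)
Lemma moments_le0 v : mu.-integrable `[-1, 1] (EFin \o v) ->
  (forall p, \int[mu]_(x in `[-1, 1]) (v x * p.[x]) = 0) ->
  forall x, -1 < x < 1 -> {for x, continuous v} -> v x <= 0.
Proof.
move=> iv v0 x0 x0I cv; rewrite leNgt; apply/negP => vx0.
have [r [r0 [[rI1 rI2] vd]]] : exists r : R, 0 < r /\ (-1 <= x0 - r /\ x0 + r <= 1) /\
    forall x, `|x - x0| <= r -> v x0 / 2 <= v x.
  have vx2 : 0 < v x0 / 2 by lra.
  have /cvgrPdist_lt/(_ _ vx2)/nbhs_ballP[e /= e0 eB] := cv.
  exists (Num.min (e / 2) (Num.min (x0 + 1) (1 - x0))); split; [|split].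
  - by rewrite !lt_min; lra.
  - have : Num.min (e / 2) (Num.min (x0 + 1) (1 - x0)) <= x0 + 1.
      by rewrite !ge_min lexx !orbT.
    have : Num.min (e / 2) (Num.min (x0 + 1) (1 - x0)) <= 1 - x0.
      by rewrite !ge_min lexx !orbT.
    by lra.
  - move=> x; rewrite le_min => /andP[xe _].
    have /eB : ball x0 e x by rewrite /ball/= distrC (le_lt_trans xe)//; lra.
    by rewrite ltr_norml; lra.
set d := v x0 / 2 in vd; have d0 : 0 < d by rewrite /d; lra.
pose c : R := 3 * r ^+ 2 / 16; have c0 : 0 < c by rewrite /c; nra.
pose J : set R := `[x0 - r / 2, x0 + r / 2]%classic.
have iJ : mu.-integrable `[-1, 1] (EFin \o \1_J).
  by apply: integrableS (integrable_indic_itv _ _ _ _).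
have iav := integrable_norm iv.
have bound N : d * (1 + c * N%:R) * r <= \int[mu]_(x in `[-1, 1]) `|v x|.
  pose q : {poly R} := 1 + (4^-1)%:P * ((r ^+ 2)%:P - ('X - x0%:P) ^+ 2).
  have qE x : (q ^+ N).[x] = (1 + (r ^+ 2 - (x - x0) ^+ 2) / 4) ^+ N.
    by rewrite horner_exp /q !hornerE; congr (_ ^+ _); ring.
  have IJ : \int[mu]_(x in `[-1, 1]) (\1_J x) = r.
    rewrite /Rintegral integral_indic//; last exact: measurable_itv.
    rewrite setIidl; last first.
      by move=> x; rewrite /J /= !in_itv/=; move: (x : R) => y; lra.
    transitivity (fine (mu `[x0 - r / 2, x0 + r / 2])); first by [].
    rewrite /mu lebesgue_measure_itv.
    by rewrite /= lte_fin ifT/=; lra.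
  rewrite -IJ -RintegralZl// -subr_le0 -RintegralB//; last first.
    exact: integrableZ.
  rewrite -(v0 (q ^+ N)); apply: le_Rintegral => //.
  - by apply: integrableB_fin => //; exact: integrableZ.
  - exact: (integrableM_cts iv (@ctsH R _ (q ^+ N))).
  - by move=> x; rewrite /= in_itv/= => xI; rewrite qE; exact: peak_power.
set M := \int[mu]_(x in _) _ in bound.
have M0 : 0 <= M by apply: Rintegral_ge0 => x _.
have t0 : 0 < d * c * r by rewrite !mulr_gt0.
have := archi_boundP (divr_ge0 M0 (ltW t0)); move: (Num.bound _) => N.
rewrite ltr_pdivrMr// => MN; have := bound N; have : 0 < d * r by rewrite mulr_gt0.
by lra.
Qed.

Lemma moments_eq0 v : mu.-integrable `[-1, 1] (EFin \o v) ->
  (forall p, \int[mu]_(x in `[-1, 1]) (v x * p.[x]) = 0) ->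
  forall x, -1 < x < 1 -> {for x, continuous v} -> v x = 0.
Proof.
move=> iv v0 x xI cv; apply/eqP; rewrite eq_le (moments_le0 iv v0)//=.
rewrite -oppr_le0; apply: (@moments_le0 (fun y => - v y)) => //.
- by have := integrableZ (-1) iv; apply: eq_integrable => // y _; rewrite /= mulN1r.
- move=> p; rewrite -[RHS](v0 (- p)); apply: eq_Rintegral => y _.
  by rewrite hornerN mulrN mulNr.
- exact: continuousN.
Qed.

(** There is one Gegenbauer polynomial in each degree, so subtracting a multiple
    of it lowers the degree. *)
Lemma gegW_span l (L : {poly R} -> R) : (0 < l)%N ->
  (forall a p q, L (a *: p + q) = a * L p + L q) ->
  (forall n, L (gegW l n) = 0) -> forall p, L p = 0.
Proof.
move=> l0 Ll LW; have L0 : L 0 = 0.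
  by have := Ll (-1) 0 0; rewrite scaler0 addr0; lra.
suff H n : forall p, (size p <= n)%N -> L p = 0 by move=> p; exact: (H (size p)).
elim: n => [|n ih] p; first by rewrite leqn0 size_poly_eq0 => /eqP ->.
move=> sp; have sW := size_gegW (R := R) n l0.
have W0 : (gegW l n : {poly R})`_n != 0.
  have := lead_coef_eq0 (gegW l n : {poly R}); rewrite lead_coefE sW => ->.
  by rewrite -size_poly_eq0 sW.
rewrite -[p](subrKC (p`_n / (gegW l n)`_n *: gegW l n)) Ll LW mulr0 add0r.
apply: ih; apply/leq_sizeP => j nj; rewrite coefB coefZ.
move: nj; rewrite leq_eqVlt => /predU1P[<-|nj]; first by rewrite mulfVK ?subrr.
rewrite [p`_j]nth_default ?(leq_trans sp)//.
by rewrite [(gegW l n)`_j]nth_default ?sW// mulr0 subr0.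
Qed.

End moments_determine.

Section thinplate_uniqueness.
Context {R : realType}.
Let mu := @lebesgue_measure R.
Implicit Types (x : R) (m n : nat) (k : R -> R).
Local Notation s := (@semicircle R).
Local Notation W := (@gegW R).

Lemma thinplate_ip m k1 k2 n :
  is_thinplate_spline (2 * m.+1 + 2) k1 -> is_thinplate_spline (2 * m.+1 + 2) k2 ->
  gegenbauer_ip m.+1%:R k1 (gegenbauerW m.+1%:R n) =
  gegenbauer_ip m.+1%:R k2 (gegenbauerW m.+1%:R n).
Proof.
rewrite /is_thinplate_spline sphere_lambdaE => -[_ _ e1 h1] [_ _ e2 h2].
case: n => [|n]; first by rewrite e1 e2.
have := h1 n.+1 isT; rewrite -(h2 n.+1 isT) gegenbauer_ip_norm.
by apply: mulIf; rewrite invr_eq0 gegnorm_neq0.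
Qed.

Lemma thinplate_unique m k : is_thinplate_spline (2 * m.+1 + 2) k ->
  forall x, -1 < x < 1 -> k x = spline m x.
Proof.
move=> tk x xI; have [L SL] := @cvg_spline R m.
have eS : {in `]-1, 1[, spline_ext m L =1 spline m}.
  by move=> y; rewrite in_itv/= => /andP[y1 _]; rewrite /spline_ext gt_eqF.
have tS := spline_thinplate eS (cts_spline_ext SL).
have := tk; rewrite /is_thinplate_spline sphere_lambdaE => -[ck ik _ _].
pose kw y := k y * s y ^+ (2 * m).+1.
have ikw : mu.-integrable `[-1, 1] (EFin \o kw).
  move: ik; apply: eq_integrable => // y; rewrite inE/= in_itv/= => yI.
  rewrite gegenbauer_weightE// /kw (_ : (2 * m.+1).-1 = (2 * m).+1)//; lia.
have iS := cts_integrable (@cts_splineW R m).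
pose v y := kw y - splineW m y.
have iv : mu.-integrable `[-1, 1] (EFin \o v) by exact: integrableB_fin.
have iM h : mu.-integrable `[-1, 1] (EFin \o h) -> forall p : {poly R},
    mu.-integrable `[-1, 1] (EFin \o (fun y => h y * p.[y])).
  by move=> ih p; apply: integrableM_cts => //; exact: ctsH.
have cv : {for x, continuous v}.
  have ckx : {for x, continuous k}.
    apply: (@within_continuous_continuous _ _ _ (-1) ((x + 1) / 2)); first by lra.
      apply: continuous_subspaceW ck => y /=; rewrite !in_itv/=; lra.
    by rewrite in_itv/=; lra.
  have c2 := @cts_splineW R m.
  have c3 := @ctsXn R `[-1, 1] s (2 * m).+1 (@cts_semicircle R _).
  have xI' : x \in `]-1, 1[ by rewrite in_itv.
  have N11 : -1 < 1 :> R by lra.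
  apply: continuousB; last exact: within_continuous_continuous N11 c2 xI'.
  by apply: continuousM => //; exact: within_continuous_continuous N11 c3 xI'.
have v0 p : \int[mu]_(y in `[-1, 1]) (v y * p.[y]) = 0.
  apply: (@gegW_span R m.+1 (fun p => \int[mu]_(y in `[-1, 1]) (v y * p.[y]))) => //.
    move=> a p1 p2; rewrite -RintegralZl -?RintegralD//; try exact: iM.
      by apply: eq_Rintegral => y _; rewrite hornerD hornerZ; ring.
    by apply: integrableZ; exact: iM.
  move=> n; have := thinplate_ip n tk tS; rewrite (spline_ip _ eS) gegenbauer_ipE.
  move/eqP; rewrite -subr_eq0 -RintegralB//; [|exact: iM..].
  by move/eqP => <-; apply: eq_Rintegral => y _; rewrite -mulrBl.
have := moments_eq0 iv v0 xI cv.
rewrite /v /kw splineWE// -mulrBl => /eqP; rewrite mulf_eq0 subr_eq0 => /orP[/eqP//|].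
by rewrite expf_eq0/= gt_eqF// semicircle_gt0.
Qed.

End thinplate_uniqueness.

(** * Affine changes of variable *)

Section affine_change_of_variables.
Context {R : realType}.
Let mu := @lebesgue_measure R.
Implicit Types (f : R -> R) (b c : R).
Local Open Scope ereal_scope.

(** The image of Lebesgue measure under x |-> c x + b, multiplied by c, agrees
    with Lebesgue measure on intervals. *)
Lemma ge0_integral_affine f b c : (0 < c)%R -> measurable_fun [set: R] f ->
  (forall x, 0 <= f x)%R ->
  \int[mu]_x (f x)%:E = c%:E * \int[mu]_x (f (c * x + b)%R)%:E.
Proof.
move=> c0 mf f0; pose T x := (c * x + b)%R.
have mT : measurable_fun [set: measurableTypeR R]
    (T : measurableTypeR R -> measurableTypeR R).
  by apply: measurable_funD => //; apply: measurable_funM.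
pose nu : {measure set (measurableTypeR R) -> \bar R} := mscale (NngNum (ltW c0))
  (measure_function_pushforward__canonical__measure_function_Measure mu mT).
have muE A : measurable A -> mu A = nu A.
  apply: lebesgue_measure_unique => _ [[u v] _ <-] /=.
  rewrite /nu /mscale/= /pushforward.
  have -> : T @^-1` `]u, v] = `](((u - b) / c)%R : R), ((v - b) / c)%R]%classic.
    by apply/seteqP; split => x /=; rewrite !in_itv/= /T;
      rewrite ltr_pdivrMr// ler_pdivlMr// ltrBlDr lerBrDr [(x * c)%R]mulrC.
  rewrite !lebesgue_measure_itv/= !lte_fin ltr_pM2r ?invr_gt0// ltrD2r.
  case: ifPn => _; last by rewrite mule0.
  by rewrite -EFinM; congr _%:E; field; rewrite gt_eqF.
transitivity (\int[nu]_x (f x)%:E).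
  by apply: eq_measure_integral => A mA _; exact: muE.
rewrite ge0_integral_mscale//; first congr (_ * _).
- rewrite (ge0_integral_pushforward mT)//; first exact/measurable_EFinP.
  by move=> x _; rewrite lee_fin.
- exact/measurable_EFinP.
- by move=> x _; rewrite lee_fin.
Qed.

End affine_change_of_variables.

(** * Finiteness and positivity of the Gamma integral *)

Section gamma_function.
Context {R : realType}.
Let mu := @lebesgue_measure R.
Implicit Types (a t : R).

(** The Gamma integrand, extended by 0 to the whole line. *)
Definition gker a t : R := if 0 < t then t `^ (a - 1) * expR (- t) else 0.

Lemma gker_ge0 a t : 0 <= gker a t.
Proof. by rewrite /gker; case: ifP => // _; rewrite mulr_ge0 ?powR_ge0 ?expR_ge0. Qed.

Lemma measurable_gker a : measurable_fun [set: R] (gker a).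
Proof.
apply: measurable_fun_ifT => //; first exact: measurable_fun_ltr.
apply: measurable_funM; first exact: measurable_powR.
by apply: measurableT_comp => //; exact: measurableT_comp.
Qed.

Lemma GammaE a : Gamma a = fine (\int[mu]_t (gker a t)%:E).
Proof.
rewrite /Gamma /Rintegral integral_mkcond; congr fine.
apply: eq_integral => t _; rewrite patchE mem_setE in_itv/= andbT /gker.
by case: ifP.
Qed.

(** A power of t is at most a constant times e ^ (t / 2), since the logarithm
    satisfies ln t <= t / (2 b) + ln (2 b). *)
Lemma gker_le_exp a t : 1 <= t ->
  gker a t <= 2 * expR ((`|a - 1| + 1) * ln (2 * (`|a - 1| + 1))) *
    exponential_pdf 2^-1 t.
Proof.
move=> t1; set b := `|a - 1| + 1; have t0 : 0 < t by lra.
have b1 : 1 <= b by rewrite /b lerDr.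
have b0 : 0 < 2 * b by lra.
rewrite /gker t0 exponential_pdfE; last by lra.
rewrite /powR gt_eqF// -expRD.
rewrite [leRHS](_ : _ = expR (b * ln (2 * b)) * expR (- 2^-1 * t)); last by field.
rewrite -expRD ler_expR.
have lnt0 : 0 <= ln t by rewrite ln_ge0.
have h1 : (a - 1) * ln t <= b * ln t.
  by rewrite ler_wpM2r// /b (le_trans (ler_norm _))// lerDl.
have h2 : ln t <= t / (2 * b) + ln (2 * b).
  have {1}-> : t = (t / (2 * b)) * (2 * b) by rewrite divfK// gt_eqF.
  rewrite lnM ?posrE ?divr_gt0// lerD2r ltW// ln_sublinear// divr_gt0//.
have h3 : b * ln t <= b * (t / (2 * b)) + b * ln (2 * b).
  by rewrite -mulrDr ler_wpM2l//; lra.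
have h4 : b * (t / (2 * b)) = t / 2 by field; rewrite gt_eqF//; lra.
by lra.
Qed.

(** The integrals over [1 / (i + 2), 1] are computed from the primitive t ^ a / a
    and increase to the one over ]0, 1]. *)
Lemma integral_powR_le a : 0 < a ->
  (\int[mu]_(t in `]0%R, 1%R]) (t `^ (a - 1))%:E <= (a^-1)%:E)%E.
Proof.
move=> a0; pose F (i : nat) := `[i.+2%:R^-1 : R, 1]%classic.
have FE : `]0 : R, 1]%classic = \bigcup_i F i.
  apply/seteqP; split => [x|x [i _]]; rewrite /F /= !in_itv/=.
    move=> /andP[x0 x1]; have [N xN] := @ltr_add_invr R 0 x x0.
    exists N => //=; rewrite in_itv/= x1 andbT.
    rewrite add0r in xN; rewrite (le_trans _ (ltW xN))// lef_pV2 ?posrE//.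
    by rewrite ler_nat.
  move=> /andP[ix ->]; rewrite andbT (lt_le_trans _ ix)//.
have mp (D : set R) : measurable_fun D (fun t => (t `^ (a - 1))%:E).
  by apply: measurable_funTS; apply/measurable_EFinP; exact: measurable_powR.
have cF : (\int[mu]_(t in F i) (t `^ (a - 1))%:E @[i --> \oo] -->
    \int[mu]_(t in \bigcup_i F i) (t `^ (a - 1))%:E)%E.
  apply: ge0_nondecreasing_set_cvg_integral => //.
  - apply/nondecreasing_seqP => n; apply/subsetPset => x; rewrite /F /= !in_itv/=.
    move=> /andP[nx ->]; rewrite andbT (le_trans _ nx)// lef_pV2 ?posrE//.
    by rewrite ler_nat.
  - by move=> i; exact: measurable_itv.
  - by move=> i; exact: mp.
  - by move=> i x _; rewrite lee_fin powR_ge0.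
rewrite FE -(cvg_lim _ cF)//; apply: lime_le; first by apply/cvg_ex; eexists; exact: cF.
apply: nearW => i; set e : R := i.+2%:R^-1.
have e0 : 0 < e by rewrite invr_gt0.
have e1 : e < 1 by rewrite invf_lt1// ltr1n.
have dP (x : R) : 0 < x -> is_derive x 1 (fun t : R => a^-1 * t `^ a) (x `^ (a - 1)).
  move=> x0; apply: (derE (derZ a^-1 (is_derive1_powR a x0))).
  by rewrite mulKf// gt_eqF.
have dp (x : R) : 0 < x -> {for x, continuous (fun t : R => t `^ (a - 1))}.
  move=> x0; apply: differentiable_continuous; apply/derivable1_diffP.
  by have [] := is_derive1_powR (a - 1) x0.
have dP' (x : R) : 0 < x -> {for x, continuous (fun t : R => a^-1 * t `^ a)}.
  move=> x0; apply: differentiable_continuous; apply/derivable1_diffP.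
  by have [] := dP x x0.
rewrite (@continuous_FTC2 _ (fun t => t `^ (a - 1)) (fun t : R => a^-1 * t `^ a))//.
- rewrite -EFinB lee_fin powR1 mulr1 gerBl mulr_ge0 ?powR_ge0// invr_ge0 ltW//.
- apply: continuous_in_subspaceT => x; rewrite inE/= in_itv/= => /andP[ex _].
  by apply: dp; exact: lt_le_trans ex.
- split.
  + move=> x; rewrite in_itv/= => /andP[ex _].
    by have [] := dP x (lt_trans e0 ex).
  + by apply: cvg_at_right_filter; apply: dP'.
  + by apply: cvg_at_left_filter; apply: dP'.
- move=> x; rewrite in_itv/= => /andP[ex _]; have := dP x (lt_trans e0 ex) => d.
  by rewrite derive1E; exact: derive_val.
Qed.

Lemma integral_gker_lty a : 0 < a -> (\int[mu]_t (gker a t)%:E < +oo)%E.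
Proof.
move=> a0; set b := `|a - 1| + 1; set C := 2 * expR (b * ln (2 * b)).
have C0 : 0 <= C by rewrite mulr_ge0// expR_ge0.
pose p (t : R) : R := if 0 < t <= 1 then t `^ (a - 1) else 0.
have mp : measurable_fun [set: R] p.
  apply: measurable_fun_ifT; [|exact: measurable_powR|exact: measurable_cst].
  apply: measurable_and; first exact: (@measurable_fun_ltr _ _ _ _ (cst 0) id).
  exact: (@measurable_fun_ler _ _ _ _ id (cst 1)).
have p0 t : 0 <= p t by rewrite /p; case: ifP; rewrite ?powR_ge0.
have me := @measurable_exponential_pdf R 2^-1.
have e0 (t : R) : 0 <= exponential_pdf 2^-1 t by apply: exponential_pdf_ge0.
apply: (@le_lt_trans _ _
  (\int[mu]_t ((p t)%:E + C%:E * (exponential_pdf 2^-1 t)%:E))%E).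
  apply: ge0_le_integral => //.
  - by move=> t _; rewrite lee_fin gker_ge0.
  - by apply/measurable_EFinP; exact: measurable_gker.
  - apply: emeasurable_funD; first exact/measurable_EFinP.
    by apply: emeasurable_funM => //; exact/measurable_EFinP.
  - move=> t _; rewrite -EFinM -EFinD lee_fin.
    have [t0|t0] := leP t 0.
      by rewrite /gker ltNge t0/= addr_ge0// mulr_ge0.
    have [t1|t1] := leP t 1.
      rewrite -[leLHS]addr0 lerD// ?mulr_ge0// /gker /p t0 t1/=.
      by rewrite ler_piMr ?powR_ge0// -expR0 ler_expR; lra.
    by rewrite -[leLHS]add0r lerD// gker_le_exp// ltW.
rewrite ge0_integralD//; first last.
- by apply: emeasurable_funM => //; exact/measurable_EFinP.
- by move=> t _; rewrite mule_ge0 ?lee_fin.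
- exact/measurable_EFinP.
- by move=> t _; rewrite lee_fin.
rewrite ge0_integralZl//; first last.
- by move=> t _; rewrite lee_fin.
- exact/measurable_EFinP.
rewrite integral_exponential_pdf// mule1 lte_add_pinfty ?ltry//.
apply: le_lt_trans (ltry a^-1); apply: le_trans (integral_powR_le a0).
rewrite [leRHS]integral_mkcond le_eqVlt; apply/orP; left; apply/eqP.
apply: eq_integral => t _; rewrite patchE /p mem_setE in_itv/=.
by case: ifP.
Qed.

Lemma integral_gker_gt0 a : (0 < \int[mu]_t (gker a t)%:E)%E.
Proof.
pose m := expR (- `|a - 1| - 2); pose J := `[1 : R, 2]%classic.
have m0 : 0 < m := expR_gt0 _.
have mJ : measurable_fun [set: R] (\1_J : R -> R).
  by apply: measurable_indic; exact: measurable_itv.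
have : (m%:E <= \int[mu]_t (gker a t)%:E)%E.
  have <- : (\int[mu]_t (m%:E * (\1_J t)%:E) = m%:E)%E.
    rewrite ge0_integralZl//.
    - rewrite integral_indic//; last exact: measurable_itv.
      rewrite setIT [X in (_ * X)%E](_ : _ = mu `[1 : R, 2])// /mu.
      rewrite lebesgue_measure_itv/= lte_fin ifT; last lra.
      by rewrite -EFinB -EFinM; congr _%:E; lra.
    - exact/measurable_EFinP.
    - by rewrite lee_fin ltW.
  apply: ge0_le_integral => //.
  - by move=> t _; rewrite -EFinM lee_fin mulr_ge0// ltW.
  - by apply: emeasurable_funM => //; apply/measurable_EFinP.
  - by apply/measurable_EFinP; exact: measurable_gker.
  move=> t _; rewrite -EFinM lee_fin indicE mem_setE in_itv/=.
  case: (boolP (_ && _)) => [/andP[t1 t2]|_]; last by rewrite mulr0 gker_ge0.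
  have t0 : 0 < t by lra.
  rewrite mulr1 /gker t0 /powR gt_eqF// -expRD ler_expR.
  have l0 : 0 <= ln t by rewrite ln_ge0.
  have l1 : ln t <= 1.
    have := @le_ln1Dx R (t - 1); rewrite (_ : 1 + (t - 1) = t); [lra|ring].
  have : - `|a - 1| <= (a - 1) * ln t.
    rewrite lerNl -mulNr (le_trans (ler_norm _))// normrM normrN.
    by rewrite (ger0_norm l0) ler_piMr.
  lra.
by apply: lt_le_trans; rewrite lte_fin.
Qed.

End gamma_function.

(** * The beta integral as a quotient of Gamma values *)

Section beta_gamma.
Context {R : realType}.
Let mu := @lebesgue_measure R.
Implicit Types (a s t x y : R).

(** The beta integrand, extended by 0 to the whole line. *)
Definition bker a y : R := if y ^+ 2 < 1 then (1 - y ^+ 2) `^ a else 0.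

Lemma bker_ge0 a y : 0 <= bker a y.
Proof. by rewrite /bker; case: ifP; rewrite ?powR_ge0. Qed.

Let measurable_sqr d (T : measurableType d) (f : T -> R) :
  measurable_fun [set: T] f -> measurable_fun [set: T] (fun z => f z ^+ 2).
Proof. by move=> mf; apply: measurable_funX. Qed.

Lemma measurable_bker a : measurable_fun [set: R] (bker a).
Proof.
apply: measurable_fun_ifT; last exact: measurable_cst.
  by apply: measurable_fun_ltr; [exact: measurable_sqr | exact: measurable_cst].
apply: (measurableT_comp (measurable_powR a)).
by apply: measurable_funB; [exact: measurable_cst | exact: measurable_sqr].
Qed.

Lemma fintE_bker a : fint a = fine (\int[mu]_y (bker a y)%:E).
Proof.
rewrite /fint /Rintegral; congr fine; rewrite integral_itv_bndoo.
  rewrite integral_mkcond; apply: eq_integral => y _.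
  rewrite patchE mem_setE in_itv/= /bker.
  have -> : (-1 < y < 1) = (y ^+ 2 < 1)
    by rewrite -ltr_norml -[y ^+ 2]real_normK ?num_real// expr_lt1.
  by case: ifP.
apply/measurable_EFinP/measurable_funTS.
apply: (measurableT_comp (measurable_powR a)).
by apply: measurable_funB; [exact: measurable_cst | exact: measurable_sqr].
Qed.

(** The density on the plane whose two iterated integrals are compared. *)
Definition paraboloid a (z : R * R) : R :=
  if z.2 ^+ 2 < z.1 then (z.1 - z.2 ^+ 2) `^ a * expR (- z.1) else 0.

Lemma paraboloid_ge0 a z : 0 <= paraboloid a z.
Proof.
by rewrite /paraboloid; case: ifP => // _; rewrite mulr_ge0 ?powR_ge0 ?expR_ge0.
Qed.

Lemma measurable_paraboloid a : measurable_fun [set: R * R] (paraboloid a).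
Proof.
have m1 : measurable_fun [set: R * R] (fst : R * R -> R) by exact: measurable_fst.
have m2 : measurable_fun [set: R * R] (fun z : R * R => z.2 ^+ 2).
  by apply: measurable_sqr; exact: measurable_snd.
apply: measurable_fun_ifT; last exact: measurable_cst.
  exact: measurable_fun_ltr.
apply: measurable_funM.
  by apply: (measurableT_comp (measurable_powR a)); exact: measurable_funB.
apply: (measurableT_comp (@measurable_expR R)).
exact: measurableT_comp.
Qed.

(** Translation by x ^ 2. *)
Lemma integral_paraboloid_s a x :
  (\int[mu]_s (paraboloid a (s, x))%:E =
   (gauss_fun x)%:E * \int[mu]_t (gker (a + 1) t)%:E)%E.
Proof.
rewrite (@ge0_integral_affine _ (fun s => paraboloid a (s, x)) (x ^+ 2) 1)//.
- rewrite mul1e -ge0_integralZl//.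
  + apply: eq_integral => t _; rewrite -EFinM /paraboloid /gker /gauss_fun/=.
    rewrite mul1r ltrDr addrK; case: ifP => _; last by rewrite mulr0.
    by rewrite opprD expRD addrK; congr _%:E; ring.
  + by apply/measurable_EFinP; exact: measurable_gker.
  + by move=> t _; rewrite lee_fin gker_ge0.
  + by rewrite lee_fin expR_ge0.
- exact: (measurableT_comp (measurable_paraboloid a) (measurable_pair2 x)).
- by move=> s; exact: paraboloid_ge0.
Qed.

(** For s > 0, dilation by the square root of s. *)
Lemma integral_paraboloid_x a s :
  (\int[mu]_x (paraboloid a (s, x))%:E =
   (gker (a + 3 / 2) s)%:E * \int[mu]_y (bker a y)%:E)%E.
Proof.
have [s0|s0] := leP s 0.
  rewrite /gker ltNge s0/= mul0e integral0_eq// => x _.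
  by rewrite /paraboloid/= ltNge (le_trans s0)// sqr_ge0.
have r0 : 0 < Num.sqrt s by rewrite sqrtr_gt0.
have r2 : Num.sqrt s ^+ 2 = s by rewrite sqr_sqrtr// ltW.
rewrite (@ge0_integral_affine _ (fun x => paraboloid a (s, x)) 0 (Num.sqrt s))//.
- have mg : measurable_fun [set: R] (fun y => paraboloid a (s, Num.sqrt s * y + 0)).
    apply: (measurableT_comp (measurable_paraboloid a)).
    apply: (measurableT_comp (measurable_pair1 s)).
    by apply: measurable_funD => //; exact: measurable_funM.
  have mb := measurable_bker a.
  rewrite -ge0_integralZl//.
  + rewrite -ge0_integralZl//.
    * apply: eq_integral => y _; rewrite -!EFinM; congr _%:E.
      rewrite /paraboloid /gker /bker/= addr0 exprMn r2 s0.
      have -> : (s * y ^+ 2 < s) = (y ^+ 2 < 1).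
        by rewrite -[X in _ < X]mulr1 ltr_pM2l.
      case: ifP => y1; last by rewrite !mulr0.
      have -> : s - s * y ^+ 2 = s * (1 - y ^+ 2) by ring.
      rewrite powRM ?ltW ?subr_gt0//.
      have -> : a + 3 / 2 - 1 = 2^-1 + a by field.
      rewrite powRD ?powR12_sqrt ?ltW//; first by ring.
      by rewrite [s == 0]gt_eqF ?implybT.
    * exact/measurable_EFinP.
    * by move=> y _; rewrite lee_fin bker_ge0.
    * by rewrite lee_fin gker_ge0.
  + exact/measurable_EFinP.
  + by move=> y _; rewrite lee_fin paraboloid_ge0.
- exact: (measurableT_comp (measurable_paraboloid a) (measurable_pair1 s)).
- by move=> x; exact: paraboloid_ge0.
Qed.

Lemma beta_gamma a :
  (\int[mu]_t (gker (a + 3 / 2) t)%:E * \int[mu]_y (bker a y)%:E =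
   (Num.sqrt pi)%:E * \int[mu]_t (gker (a + 1) t)%:E)%E.
Proof.
have g0 b : (0 <= \int[mu]_t (gker b t)%:E)%E.
  by apply: integral_ge0 => t _; rewrite lee_fin gker_ge0.
have b0 : (0 <= \int[mu]_y (bker a y)%:E)%E.
  by apply: integral_ge0 => t _; rewrite lee_fin bker_ge0.
rewrite -ge0_integralZr//; first last.
- by move=> t _; rewrite lee_fin gker_ge0.
- by apply/measurable_EFinP; exact: measurable_gker.
rewrite -integralT_gauss -ge0_integralZr//; first last.
- by move=> t _; rewrite lee_fin gauss_fun_ge0.
- by apply/measurable_EFinP; exact: measurable_gauss_fun.
under eq_integral do rewrite -integral_paraboloid_x.
under [RHS]eq_integral do rewrite -integral_paraboloid_s.
apply: (@fubini_tonelli _ _ _ _ R mu mu (EFin \o paraboloid a)).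
  by apply/measurable_EFinP; exact: measurable_paraboloid.
by move=> z; rewrite lee_fin paraboloid_ge0.
Qed.

Lemma fint_Gamma a : -1 < a ->
  fint a = Num.sqrt pi * Gamma (a + 1) / Gamma (a + 3 / 2).
Proof.
move=> a1; rewrite fintE_bker !GammaE; have := beta_gamma a.
have p1 : 0 < a + 1 by lra.
have p3 : 0 < a + 3 / 2 by lra.
have := integral_gker_lty p1; have := integral_gker_gt0 (a + 1).
have := integral_gker_lty p3; have := integral_gker_gt0 (a + 3 / 2).
have : (0 <= \int[mu]_y (bker a y)%:E)%E.
  by apply: integral_ge0 => t _; rewrite lee_fin bker_ge0.
move: (\int[mu]_y (bker a y)%:E)%E (\int[mu]_t (gker (a + 3 / 2) t)%:E)%E
  (\int[mu]_t (gker (a + 1) t)%:E)%E => [F||] [g||] [h||]//=.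
- rewrite !lte_fin -!EFinM => _ g0 _ _ _ [e].
  by rewrite -e [g * F]mulrC mulfK// gt_eqF.
- by move=> _ g0 _ _ _; rewrite gt0_muley.
Qed.

End beta_gamma.

(** * The theorem *)

Lemma splineE {R : realType} m (x : R) : -1 < x < 1 ->
  spline m x = (pi / 2 + asin x) *
    (\sum_(1 <= j < m.+2) c_coef R m.+1 j * x * (1 - x ^+ 2) `^ (- j%:R + 2^-1))
  + (\sum_(1 <= j < m.+1) d_coef R m.+1 j * (1 - x ^+ 2) ^- j) - C_const R m.+1.
Proof.
move=> xI; have xI' : -1 <= x <= 1 by lra.
rewrite /spline /polesum; congr (_ * _ + _ - _); rewrite big_add1/=.
  rewrite mulr_sumr; apply: eq_big_nat => i _.
  have -> : - i.+1%:R + 2^-1 = - (i%:R + 2^-1) :> R by rewrite -natr1; field.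
  by rewrite powRN powR_semicircle// c_coefE; ring.
apply: eq_big_nat => i _; rewrite -semicircle_sqr// -exprM.
by rewrite (_ : (2 * i.+1)%N = (2 * i).+2)//; lia.
Qed.

Unset Implicit Arguments.

Theorem mainTheorem2 (R : realType) (l d : nat)
    (l_gt0 : (0 < l)%N) (dE : d = (2 * l + 2)%N) :
  [/\ exists k : R -> R, is_thinplate_spline d k,
      forall k : R -> R, is_thinplate_spline d k ->
        forall x : R, -1 < x < 1 ->
          k x = (pi / 2 + asin x) *
                  (\sum_(1 <= j < l.+1)
                     c_coef R l j * x * (1 - x ^+ 2) `^ (- j%:R + 2^-1))
                + (\sum_(1 <= j < l) d_coef R l j * (1 - x ^+ 2) ^- j)
                - C_const R l &
      forall mu : R, -1 < mu ->
        fint mu = Num.sqrt pi * Gamma (mu + 1) / Gamma (mu + 3 / 2)].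
Proof.
subst d; case: l l_gt0 => // m _; split; last exact: fint_Gamma.
- have [L SL] := @cvg_spline R m; exists (spline_ext m L).
  apply: (@spline_thinplate R m); last exact: cts_spline_ext.
  by move=> y; rewrite in_itv/= => /andP[y1 _]; rewrite /spline_ext gt_eqF.
- by move=> k tk x xI; rewrite (thinplate_unique tk xI) splineE.
Qed.
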